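(* Let $G$ be an abelian group, let $g\in G$ be such that $g^2\ne1$, let $\mathbb{K}$ be an infinite field, and let $J\subseteq\mathcal{L}(X^G)$ be a $T_G$-ideal such that $\mathrm{Id}_G(\mathrm{UT}_3^{(-)}(\mathbb{K}),\Gamma(g,g^{-1}))\subseteq J$. Then there exists a finite subset $S\subseteq\mathcal{L}(X^G)$ such that $$J=\langle S\rangle^{T_G}+\mathrm{Id}_G(\mathrm{UT}_3^{(-)},\Gamma(g,g^{-1})).$$
   Context: $\mathrm{UT}_3^{(-)}=\mathrm{UT}_3(\mathbb{K})^{(-)}$ is the Lie algebra of upper triangular $3\times3$ matrices over $\mathbb{K}$ with bracket $[a,b]=ab-ba$; $e_{ij}$ are matrix units. For an abelian group $G$ (multiplicative, neutral element $1$) and $g,h\in G$, $\Gamma(g,h)$ is the $G$-grading on $\mathrm{UT}_3^{(-)}$ with $\deg e_{ii}=1$, $\deg e_{12}=g$, $\deg e_{23}=h$, $\deg e_{13}=gh$. $\mathcal{L}(X^G)$ is the free $G$-graded Lie algebra over $\mathbb{K}$ freely generated by $X^G=\{x_{i,g}\mid i\in\mathbb{N},g\in G\}$ with $\deg x_{i,g}=g$. $\mathrm{Id}_G(\mathrm{UT}_3^{(-)},\Gamma)$ is the set of $f\in\mathcal{L}(X^G)$ that vanish under every graded homomorphism $\mathcal{L}(X^G)\to(\mathrm{UT}_3^{(-)},\Gamma)$. A $T_G$-ideal is an ideal of $\mathcal{L}(X^G)$ invariant under all graded endomorphisms, and $\langle S\rangle^{T_G}$ is the $T_G$-ideal generated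 by $S$. *)

(* Defs.v *)
From HB Require Import structures.
From mathcomp Require Import all_boot all_algebra.
From mathcomp Require Import boolp classical_sets.

Set Implicit Arguments.
Unset Strict Implicit.
Unset Printing Implicit Defensive.

Import GRing.Theory.
Local Open Scope classical_set_scope.
Local Open Scope ring_scope.
Local Open Scope quotient_scope.

(* Lie algebras over a field of arbitrary characteristic: the bracket is
   alternating, which is stronger than antisymmetric in characteristic 2. *)

HB.mixin Record Lmodule_isLie (K : fieldType) L of GRing.Lmodule K L := {
  lieb : L -> L -> L;
  lieb_linearl : forall y, linear (fun x => lieb x y);
  lieb_linearr : forall x, linear (lieb x);
  liebxx : forall x, lieb x x = 0;
  lieb_jacobi : forall x y z,
    lieb x (lieb y z) + lieb y (lieb z x) + lieb z (lieb x y) = 0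
}.

#[short(type="lieAlgType")]
HB.structure Definition LieAlgebra (K : fieldType) :=
  {L of Lmodule_isLie K L & GRing.Lmodule K L}.

Definition lie_hom (K : fieldType) (L M : lieAlgType K) (phi : L -> M) : Prop :=
  linear phi /\ {morph phi : x y / lieb x y}.

Definition span (K : fieldType) (V : lmodType K) (A : set V) : set V :=
  smallest (fun W : set V => submod_closed (mem W)) A.

Definition lie_ideal (K : fieldType) (L : lieAlgType K) (J : set L) : Prop :=
  submod_closed (mem J) /\ forall x y, J y -> J (lieb x y).

(* A grading is given by its family of homogeneous components. *)
Definition graded_hom (G : Type) (K : fieldType) (L M : lieAlgType K)
    (gL : G -> set L) (gM : G -> set M) (phi : L -> M) : Prop :=
  lie_hom phi /\ forall d x, gL d x -> gM d (phi x).

(* The free Lie algebra on a type X, presented as the quotient of the terms in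
   the operations of Lie algebras by the congruence that their axioms
   generate. *)
Section FreeLie.
Variables (K : fieldType) (X : Type).

Inductive lie_term : Type :=
| LVar of X
| LZero
| LOpp of lie_term
| LAdd of lie_term & lie_term
| LScale of K & lie_term
| LBr of lie_term & lie_term.

Inductive lie_eq : lie_term -> lie_term -> Prop :=
| lie_refl s : lie_eq s s
| lie_sym s t : lie_eq s t -> lie_eq t s
| lie_trans t s u : lie_eq s t -> lie_eq t u -> lie_eq s u
| lie_congN s s' : lie_eq s s' -> lie_eq (LOpp s) (LOpp s')
| lie_congD s s' t t' :
    lie_eq s s' -> lie_eq t t' -> lie_eq (LAdd s t) (LAdd s' t')
| lie_congZ a s s' : lie_eq s s' -> lie_eq (LScale a s) (LScale a s')
| lie_congB s s' t t' :
    lie_eq s s' -> lie_eq t t' -> lie_eq (LBr s t) (LBr s' t')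
| lie_addA s t u : lie_eq (LAdd s (LAdd t u)) (LAdd (LAdd s t) u)
| lie_addC s t : lie_eq (LAdd s t) (LAdd t s)
| lie_add0 s : lie_eq (LAdd LZero s) s
| lie_addN s : lie_eq (LAdd (LOpp s) s) LZero
| lie_scaleA a b s : lie_eq (LScale a (LScale b s)) (LScale (a * b) s)
| lie_scale1 s : lie_eq (LScale 1 s) s
| lie_scaleDr a s t :
    lie_eq (LScale a (LAdd s t)) (LAdd (LScale a s) (LScale a t))
| lie_scaleDl a b s :
    lie_eq (LScale (a + b) s) (LAdd (LScale a s) (LScale b s))
| lie_brDl a s t u :
    lie_eq (LBr (LAdd (LScale a s) t) u) (LAdd (LScale a (LBr s u)) (LBr t u))
| lie_brDr a s t u :
    lie_eq (LBr u (LAdd (LScale a s) t)) (LAdd (LScale a (LBr u s)) (LBr u t))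
| lie_brxx s : lie_eq (LBr s s) LZero
| lie_brJ s t u :
    lie_eq (LAdd (LAdd (LBr s (LBr t u)) (LBr t (LBr u s))) (LBr u (LBr s t)))
           LZero.

HB.instance Definition _ := gen_eqMixin lie_term.
HB.instance Definition _ := gen_choiceMixin lie_term.

Definition lie_eqb (s t : lie_term) : bool := `[< lie_eq s t >].

Lemma lie_eqb_refl : reflexive lie_eqb.
Proof. by move=> s; apply/asboolP; exact: lie_refl. Qed.

Lemma lie_eqb_sym : symmetric lie_eqb.
Proof. by move=> s t; apply: asbool_equiv_eq; split; exact: lie_sym. Qed.

Lemma lie_eqb_trans : transitive lie_eqb.
Proof.
move=> t s u /asboolP st /asboolP tu; apply/asboolP; exact: lie_trans st tu.
Qed.

Canonical lie_equiv := EquivRel lie_eqb lie_eqb_refl lie_eqb_sym lie_eqb_trans.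

Definition freeLie : Type := {eq_quot lie_equiv}.
HB.instance Definition _ := Choice.on freeLie.

Definition free_class (t : lie_term) : freeLie := \pi_{eq_quot lie_equiv} t.
Definition free_repr (x : freeLie) : lie_term :=
  repr (x : {eq_quot lie_equiv}).

Lemma free_reprK x : free_class (free_repr x) = x.
Proof. exact: reprK. Qed.

Lemma free_classP s t : free_class s = free_class t <-> lie_eq s t.
Proof.
split=> [e|st].
  by apply/asboolP; have /eqmodP := e.
by apply/eqmodP/asboolP.
Qed.

Lemma repr_free_class t : lie_eq (free_repr (free_class t)) t.
Proof. by apply/free_classP; rewrite free_reprK. Qed.

Definition free_zero : freeLie := free_class LZero.
Definition free_opp x : freeLie := free_class (LOpp (free_repr x)).
Definition free_add x y : freeLie :=
  free_class (LAdd (free_repr x) (free_repr y)).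
Definition free_scale a x : freeLie := free_class (LScale a (free_repr x)).
Definition free_br x y : freeLie :=
  free_class (LBr (free_repr x) (free_repr y)).

Lemma free_oppE s : free_opp (free_class s) = free_class (LOpp s).
Proof. by apply/free_classP/lie_congN/repr_free_class. Qed.

Lemma free_addE s t :
  free_add (free_class s) (free_class t) = free_class (LAdd s t).
Proof. by apply/free_classP/lie_congD; apply: repr_free_class. Qed.

Lemma free_scaleE a s : free_scale a (free_class s) = free_class (LScale a s).
Proof. by apply/free_classP/lie_congZ/repr_free_class. Qed.

Lemma free_brE s t :
  free_br (free_class s) (free_class t) = free_class (LBr s t).
Proof. by apply/free_classP/lie_congB; apply: repr_free_class. Qed.

Lemma free_addA : associative free_add.
Proof.
move=> x y z; rewrite -(free_reprK x) -(free_reprK y) -(free_reprK z).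
by rewrite !free_addE; apply/free_classP/lie_addA.
Qed.

Lemma free_addC : commutative free_add.
Proof.
move=> x y; rewrite -(free_reprK x) -(free_reprK y) !free_addE.
exact/free_classP/lie_addC.
Qed.

Lemma free_add0 : left_id free_zero free_add.
Proof.
move=> x; rewrite -(free_reprK x) free_addE; exact/free_classP/lie_add0.
Qed.

Lemma free_addN : left_inverse free_zero free_opp free_add.
Proof.
move=> x; rewrite -(free_reprK x) free_oppE free_addE.
exact/free_classP/lie_addN.
Qed.

HB.instance Definition _ :=
  GRing.isZmodule.Build freeLie free_addA free_addC free_add0 free_addN.

Lemma free_scaleA a b x : free_scale a (free_scale b x) = free_scale (a * b) x.
Proof.
by rewrite -(free_reprK x) !free_scaleE; apply/free_classP/lie_scaleA.
Qed.

Lemma free_scale1 : left_id 1 free_scale.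
Proof.
by move=> x; rewrite -(free_reprK x) free_scaleE; apply/free_classP/lie_scale1.
Qed.

Lemma free_scaleDr : right_distributive free_scale +%R.
Proof.
move=> a x y; rewrite -(free_reprK x) -(free_reprK y) /GRing.add /=.
by rewrite free_addE !free_scaleE free_addE; apply/free_classP/lie_scaleDr.
Qed.

Lemma free_scaleDl x : {morph free_scale^~ x : a b / a + b}.
Proof.
move=> a b; rewrite -(free_reprK x) [in RHS]/GRing.add /=.
by rewrite !free_scaleE free_addE; apply/free_classP/lie_scaleDl.
Qed.

HB.instance Definition _ := GRing.Zmodule_isLmodule.Build K freeLie
  free_scaleA free_scale1 free_scaleDr free_scaleDl.

Lemma free_class0 : free_class LZero = 0. Proof. by []. Qed.

Lemma free_classN s : free_class (LOpp s) = - free_class s.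
Proof. by rewrite -free_oppE. Qed.

Lemma free_classD s t : free_class (LAdd s t) = free_class s + free_class t.
Proof. by rewrite -free_addE. Qed.

Lemma free_classZ a s : free_class (LScale a s) = a *: free_class s.
Proof. by rewrite -free_scaleE. Qed.

Lemma free_br_linearl y : linear (fun x => free_br x y).
Proof.
move=> a x z; rewrite -(free_reprK x) -(free_reprK y) -(free_reprK z).
rewrite -free_classZ -free_classD !free_brE -free_classZ -free_classD.
exact/free_classP/lie_brDl.
Qed.

Lemma free_br_linearr x : linear (free_br x).
Proof.
move=> a y z; rewrite -(free_reprK x) -(free_reprK y) -(free_reprK z).
rewrite -free_classZ -free_classD !free_brE -free_classZ -free_classD.
exact/free_classP/lie_brDr.
Qed.

Lemma free_brxx x : free_br x x = 0.
Proof. rewrite -(free_reprK x) free_brE; exact/free_classP/lie_brxx. Qed.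

Lemma free_br_jacobi x y z :
  free_br x (free_br y z) + free_br y (free_br z x) + free_br z (free_br x y)
  = 0.
Proof.
rewrite -(free_reprK x) -(free_reprK y) -(free_reprK z) !free_brE.
rewrite -!free_classD; exact/free_classP/lie_brJ.
Qed.

HB.instance Definition _ := Lmodule_isLie.Build K freeLie
  free_br_linearl free_br_linearr free_brxx free_br_jacobi.

Lemma free_classB s t :
  free_class (LBr s t) = lieb (free_class s) (free_class t).
Proof. by rewrite -free_brE. Qed.

Definition free_gen (x : X) : freeLie := free_class (LVar x).

Section UniversalProperty.
Variables (L : lieAlgType K) (f : X -> L).

Fixpoint lie_eval (t : lie_term) : L :=
  match t with
  | LVar x => f x
  | LZero => 0
  | LOpp s => - lie_eval s
  | LAdd s u => lie_eval s + lie_eval u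
  | LScale a s => a *: lie_eval s
  | LBr s u => lieb (lie_eval s) (lie_eval u)
  end.

Lemma lie_evalP s t : lie_eq s t -> lie_eval s = lie_eval t.
Proof.
elim=> {s t} //=.
- by move=> s t u _ -> _ ->.
- by move=> s s' _ ->.
- by move=> s s' t t' _ -> _ ->.
- by move=> a s s' _ ->.
- by move=> s s' t t' _ -> _ ->.
- by move=> *; rewrite addrA.
- by move=> *; rewrite addrC.
- by move=> *; rewrite add0r.
- by move=> *; rewrite addNr.
- by move=> *; rewrite scalerA.
- by move=> *; rewrite scale1r.
- by move=> *; rewrite scalerDr.
- by move=> *; rewrite scalerDl.
- by move=> a s t u; rewrite lieb_linearl.
- by move=> a s t u; rewrite lieb_linearr.
- by move=> s; rewrite liebxx.
- by move=> s t u; rewrite lieb_jacobi.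
Qed.

Definition free_lift (x : freeLie) : L := lie_eval (free_repr x).

Lemma free_lift_class t : free_lift (free_class t) = lie_eval t.
Proof. exact/lie_evalP/repr_free_class. Qed.

Lemma free_lift_hom : lie_hom free_lift.
Proof.
split=> [a x y|x y]; rewrite -(free_reprK x) -(free_reprK y).
  by rewrite -free_classZ -free_classD !free_lift_class.
by rewrite -free_classB !free_lift_class.
Qed.

Lemma free_lift_gen x : free_lift (free_gen x) = f x.
Proof. exact: free_lift_class. Qed.

Lemma free_lift_unique phi :
  lie_hom phi -> (forall x, phi (free_gen x) = f x) -> phi =1 free_lift.
Proof.
move=> [philin phibr] phiX x; rewrite -(free_reprK x) free_lift_class.
have phi0 : phi 0 = 0.
  by have := philin (-1) 0 0; rewrite scaler0 addr0 scaleN1r addNr.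
elim: (free_repr x) => //= [s IH|s IHs t IHt|a s IH|s IHs t IHt].
- by rewrite free_classN -scaleN1r -[_ *: _]addr0 philin phi0 addr0 scaleN1r IH.
- by rewrite free_classD -[free_class s]scale1r philin scale1r IHs IHt.
- by rewrite free_classZ -[_ *: _]addr0 philin phi0 addr0 IH.
- by rewrite free_classB phibr IHs IHt.
Qed.

End UniversalProperty.
End FreeLie.

(* The G-grading of the free Lie algebra on the variables x_(i,g). *)
Section FreeGraded.
Variables (K : fieldType) (G : groupType).

Definition freeGLie : lieAlgType K := freeLie K (nat * G).

Inductive lie_monomial : G -> freeGLie -> Prop :=
| lie_monomial_var i g : lie_monomial g (free_gen K (i, g))
| lie_monomial_br g h u v : lie_monomial g u -> lie_monomial h v ->
    lie_monomial (g * h)%g (lieb u v).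

Definition free_grading (d : G) : set freeGLie := span (lie_monomial d).

Definition T_ideal (J : set freeGLie) : Prop :=
  lie_ideal J /\
  forall phi : freeGLie -> freeGLie,
    graded_hom free_grading free_grading phi -> forall f, J f -> J (phi f).

Definition T_ideal_gen (S : set freeGLie) : set freeGLie := smallest T_ideal S.

Definition graded_identities (L : lieAlgType K) (gL : G -> set L) :
    set freeGLie :=
  [set f | forall phi, graded_hom free_grading gL phi -> phi f = 0].

End FreeGraded.

Section UT3.
Variable K : fieldType.

Definition upper_trig : {pred 'M[K]_3} :=
  fun A => [forall i : 'I_3, forall j : 'I_3, (j < i)%N ==> (A i j == 0)].

Lemma upper_trigP (A : 'M[K]_3) :
  reflect (forall i j : 'I_3, (j < i)%N -> A i j = 0) (A \in upper_trig).
Proof.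
apply: (iffP forallP) => [h i j ji|h i].
  by have /forallP/(_ j)/implyP/(_ ji)/eqP := h i.
by apply/forallP => j; apply/implyP => ji; rewrite h.
Qed.

Lemma upper_trig_submod : submod_closed upper_trig.
Proof.
split=> [|a A B /upper_trigP hA /upper_trigP hB]; apply/upper_trigP => i j ji.
  by rewrite mxE.
by rewrite !mxE hA // hB // mulr0 addr0.
Qed.

HB.instance Definition _ :=
  GRing.isSubmodClosed.Build K 'M[K]_3 upper_trig upper_trig_submod.

Lemma upper_trigM (A B : 'M[K]_3) :
  A \in upper_trig -> B \in upper_trig -> A * B \in upper_trig.
Proof.
move=> /upper_trigP hA /upper_trigP hB; apply/upper_trigP => i j ji.
rewrite mxE big1 // => k _; have [ki|ik] := ltnP k i.
  by rewrite hA // mul0r.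
by rewrite hB ?mulr0 // (leq_trans ji).
Qed.

Record UT3 := MkUT3 { ut3_mx :> 'M[K]_3; ut3_mxP : ut3_mx \in upper_trig }.

HB.instance Definition _ := [isSub for ut3_mx].
HB.instance Definition _ := [Choice of UT3 by <:].
HB.instance Definition _ := [SubChoice_isSubLmodule of UT3 by <:].

Lemma ut3_br_subproof (A B : UT3) :
  (ut3_mx A * ut3_mx B - ut3_mx B * ut3_mx A) \in upper_trig.
Proof. by rewrite rpredB // upper_trigM // ut3_mxP. Qed.

Definition ut3_br (A B : UT3) : UT3 := MkUT3 (ut3_br_subproof A B).

Lemma ut3_br_linearl B : linear (fun A => ut3_br A B).
Proof.
move=> a A C; apply: val_inj; rewrite /= mulrDl mulrDr scalerBr.
by rewrite -scalerAl -scalerAr opprD addrACA.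
Qed.

Lemma ut3_br_linearr A : linear (ut3_br A).
Proof.
move=> a B C; apply: val_inj; rewrite /= mulrDl mulrDr scalerBr.
by rewrite -scalerAl -scalerAr opprD addrACA.
Qed.

Lemma ut3_brxx A : ut3_br A A = 0.
Proof. by apply: val_inj; rewrite /= subrr. Qed.

Lemma ut3_br_jacobi A B C :
  ut3_br A (ut3_br B C) + ut3_br B (ut3_br C A) + ut3_br C (ut3_br A B) = 0.
Proof.
apply: val_inj; rewrite /= !mulrBl !mulrBr !mulrA !opprB.
move: (ut3_mx A) (ut3_mx B) (ut3_mx C) => a b c.
set p := a * b * c; set q := b * c * a; set r := c * a * b.
set p' := a * c * b; set q' := b * a * c; set r' := c * b * a.
rewrite -[RHS](subrr (p + q + r + (p' + q' + r'))) !opprD !addrA.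
by rewrite [LHS](ACl (1*5*9*7*11*3*12*4*8*2*6*10)).
Qed.

HB.instance Definition _ := Lmodule_isLie.Build K UT3
  ut3_br_linearl ut3_br_linearr ut3_brxx ut3_br_jacobi.

Variable G : groupType.

(* Only the values at i <= j matter. *)
Definition ut3_deg (g h : G) (i j : 'I_3) : G :=
  match val i, val j with
  | 0, 1 => g
  | 1, 2 => h
  | 0, 2 => (g * h)%g
  | _, _ => 1%g
  end%N.

(* A matrix unit that lies in UT3 is some e_(i,j) with i <= j. *)
Definition Gamma (g h : G) (d : G) : set UT3 :=
  span [set E : UT3 |
    exists i j : 'I_3, ut3_deg g h i j = d /\ ut3_mx E = delta_mx i j].

End UT3.

Arguments Gamma K {G} g h d.

(* Main.v *)
Require Import Defs.
From mathcomp Require Import all_boot all_algebra.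
From mathcomp Require Import boolp classical_sets cardinality.
From mathcomp Require Import zify ring.

(* Write y_i, z_i, w_i for the variables of degrees 1, g, g^-1. Modulo the
   identities of UT3, the free algebra is spanned by the y_i, by y^a z_i, y^b w_j,
   [y^a z_i, y^b w_j] and y^a [y_i, y_j], where y^a is the product of the powers
   (ad y_k)^(a_k). On y^a z_i, y^b w_j and the brackets of degree 1, ad y_k acts as
   multiplication by alpha_k, beta_k and alpha_k + beta_k respectively, so each
   family is a module of commutative monomials, on which increasing renamings of
   the variables and multiplications by monomials preserve T-ideals. By Higman's
   lemma these operations make the monomials a well-quasi-order, so that finitely
   many leading monomials generate all leading monomials of J, and J is reduced to
   finitely many elements as in Hilbert's basis theorem. The reduction works with
   formal monomials, hence needs no linear independence; setting some variables
   to 0 splits an element of J into its parts in the various families. *)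

Set Implicit Arguments.
Unset Strict Implicit.
Unset Printing Implicit Defensive.

Import GRing.Theory.
(* [vector] also exports a [span]. *)
Local Notation span := Defs.span.
Local Open Scope classical_set_scope.
Local Open Scope ring_scope.

(** * Well-quasi-orders and monomials *)

(** The form of well-quasi-order that yields a whole increasing subsequence: unlike the existence of
    a single good pair, it passes to products by extracting twice. *)
Definition monotone_wqo (A : Type) (R : A -> A -> Prop) : Prop :=
  forall f : nat -> A, exists h : nat -> nat,
    forall i j, (i < j)%N -> (h i < h j)%N /\ R (f (h i)) (f (h j)).

Lemma nat_monotone_wqo : monotone_wqo (fun m n : nat => (m <= n)%N).
Proof.
move=> f.
have min_tail n : exists m, (n <= m)%N /\ forall k, (n <= k)%N -> (f m <= f k)%N.
  suff H v : forall m, (n <= m)%N -> (f m <= v)%N ->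
      exists m, (n <= m)%N /\ forall k, (n <= k)%N -> (f m <= f k)%N.
    exact: (H (f n) n).
  elim: v => [|v IH] m nm fm; first by exists m; split=> // k _; lia.
  have [[k [nk fk]]|no] := pselect (exists k, (n <= k)%N /\ (f k < f m)%N).
    by apply: (IH k nk); lia.
  exists m; split=> // k nk; rewrite leqNgt; apply/negP => fk; apply: no.
  by exists k.
have [next nextP] := choice min_tail.
(* [next n] is an index at or after [n] where the tail of [f] is minimal; restarting just after each
   such index gives a non-decreasing subsequence. *)
pose h := fix h i := if i is i'.+1 then next (h i').+1 else next 0.
have hS i : (h i < h i.+1)%N by case: (nextP (h i).+1).
have hlt i j : (i < j)%N -> (h i < h j)%N.
  by elim: j => // j IH; rewrite ltnS leq_eqVlt => /orP[/eqP->|/IH /ltn_trans->].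
exists h => i j ij; split; first exact: hlt.
case: i ij => [|i] ij; first exact: (nextP 0).2.
by apply: (nextP (h i).+1).2; have := hlt _ _ ij; have := hS i; lia.
Qed.

Lemma monotone_wqo_prod (A B : Type) (R : A -> A -> Prop) (R' : B -> B -> Prop) :
  monotone_wqo R -> monotone_wqo R' ->
  monotone_wqo (fun x y : A * B => R x.1 y.1 /\ R' x.2 y.2).
Proof.
move=> wR wR' f.
have [h hP] := wR (fun i => (f i).1); have [k kP] := wR' (fun i => (f (h i)).2).
exists (fun i => h (k i)) => i j /kP[/hP[hij rij] rij']; by split.
Qed.

(** * Higman's lemma *)

Section Higman.
Variables (A : Type) (R : A -> A -> Prop).

Inductive embeds : seq A -> seq A -> Prop :=
| embeds_nil : embeds [::] [::]
| embeds_skip y u v : embeds u v -> embeds u (y :: v)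
| embeds_cons x y u v : R x y -> embeds u v -> embeds (x :: u) (y :: v).

Let bad (f : nat -> seq A) := forall i j, (i < j)%N -> ~ embeds (f i) (f j).

Lemma embeds0s v : embeds [::] v.
Proof. by elim: v => [|y v IH]; [exact: embeds_nil|exact: embeds_skip]. Qed.

(* Each stage minimises one more term among the bad sequences that share the
   earlier terms. *)
Lemma minimal_bad (f : nat -> seq A) : bad f ->
  exists m, bad m /\ forall n f', bad f' -> (forall i, (i < n)%N -> f' i = m i) ->
    (size (m n) <= size (f' n))%N.
Proof.
move=> badf.
pose agree n (p q : nat -> seq A) := forall i, (i < n)%N -> q i = p i.
have step (n : nat) (p : {p | bad p}) : exists q : {q | bad q},
    agree n (sval p) (sval q) /\
    forall r, bad r -> agree n (sval p) r -> (size (sval q n) <= size (r n))%N.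
  suff H v : forall q, bad q -> agree n (sval p) q -> (size (q n) <= v)%N ->
      exists q : {q | bad q}, agree n (sval p) (sval q) /\
      forall r, bad r -> agree n (sval p) r -> (size (sval q n) <= size (r n))%N.
    by case: p H => p badp /= H; apply: (H (size (p n)) p).
  elim: v => [|v IH] q badq pq qv.
    by exists (exist _ q badq); split=> //= r _ _; lia.
  have [[r [badr pr rq]]|no] := pselect (exists r,
      [/\ bad r, agree n (sval p) r & (size (r n) < size (q n))%N]).
    by apply: (IH r badr pr); lia.
  exists (exist _ q badq); split=> //= r badr pr; rewrite leqNgt; apply/negP => rq.
  by apply: no; exists r.
have [next nextP] := choice (fun np => step np.1 np.2).
pose s := fix s n := if n is n'.+1 then next (n', s n') else exist _ f badf.
have sS n k : (sval (s (n.+1 + k)%N) n = sval (s n.+1) n).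
  elim: k => [|k IH]; rewrite ?addn0 // addnS /= -IH.
  by apply: (nextP (_, _)).1 => /=; lia.
have sE n k : (n < k)%N -> sval (s k) n = sval (s n.+1) n.
  by move=> nk; rewrite -(subnKC nk) sS.
(* The diagonal sequence: term [n] no longer changes after stage [n.+1], so any two of its terms
   belong to one common bad sequence. *)
exists (fun n => sval (s n.+1) n); split=> [i j ij|n r badr rn].
  by rewrite -(sE i j.+1) ?ltnS 1?ltnW //; apply: (svalP (s j.+1)).
apply: (nextP (n, s n)).2 => //= i ik; rewrite rn //= -/s.
by rewrite -(sE i n).
Qed.

(** Nash-Williams' argument: in a minimal bad sequence no word is empty, and tails taken along a
    subsequence with increasing first letters would form a smaller bad sequence. *)
Lemma higman : monotone_wqo R ->
  forall f : nat -> seq A, exists i j, (i < j)%N /\ embeds (f i) (f j).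
Proof.
move=> wR f; apply: contrapT => nogood.
have /minimal_bad[m [badm minm]] : bad f.
  by move=> i j ij fij; apply: nogood; exists i, j.
have consm n : exists xt : A * seq A, m n = xt.1 :: xt.2.
  case E: (m n) => [|x t]; last by exists (x, t).
  by case: (badm n n.+1) => //; rewrite E; exact: embeds0s.
have [xt xtE] := choice consm.
have [h hP] := wR (fun n => (xt n).1).
have h0 k : (h 0 <= h k)%N by case: k => // k; apply/ltnW; case: (hP 0 k.+1).
(* The terms of [m] before [h 0], followed by the tails of the selected terms. It is shown to be
   bad, yet its term at [h 0] is shorter than that of [m]. *)
pose r k := if (k < h 0)%N then m k else (xt (h (k - h 0)%N)).2.
have: (size (m (h 0)) <= size (r (h 0)))%N.
  apply: minm => [i j ij|i ih]; last by rewrite /r ih.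
  rewrite /r; case: ltnP => ih; case: ltnP => jh.
  - exact: badm.
  - move=> /(embeds_skip (xt (h (j - h 0)%N)).1); rewrite -xtE.
    by apply: badm; apply: leq_trans ih _.
  - by lia.
  - have [lt_h le_x] : _ /\ _ := hP (i - h 0)%N (j - h 0)%N ltac:(lia).
    by move=> /(embeds_cons le_x); rewrite -!xtE; apply: badm.
by rewrite /r ltnn subnn xtE /= ltnn.
Qed.

End Higman.

(** Without a finite basis, one could choose forever elements of [P] that lie above none of the
    earlier choices; such a sequence has no good pair. *)
Lemma wqo_finite_basis (A : choiceType) (P : A -> Prop) (R : A -> A -> Prop) :
  (forall f : nat -> A, (forall i, P (f i)) ->
     exists i j, (i < j)%N /\ R (f i) (f j)) ->
  exists s : seq A, (forall a, a \in s -> P a) /\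
    forall a, P a -> exists2 b, b \in s & R b a.
Proof.
move=> wR; apply: contrapT => nobasis.
have new (s : seq A) : exists a, (forall b, b \in s -> P b) ->
    P a /\ forall b, b \in s -> ~ R b a.
  have [sP|/existsNP[b nPb]] := pselect (forall b, b \in s -> P b);
    last by exists b => /(_ b).
  apply: contrapT => no; apply: nobasis; exists s; split=> // a Pa.
  apply: contrapT => noa; apply: no; exists a => _; split=> // b bs Rba.
  by apply: noa; exists b.
have [next nextP] := choice new.
pose s := fix s n := if n is n'.+1 then rcons (s n') (next (s n')) else [::].
have sP n b : b \in s n -> P b.
  elim: n b => // n IH b; rewrite /= mem_rcons inE => /orP[/eqP->|/IH//].
  exact: (nextP _ IH).1.
have in_s i j : (i < j)%N -> next (s i) \in s j.
  elim: j => // j IH; rewrite ltnS leq_eqVlt /= mem_rcons inE.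
  by case/orP=> [/eqP->|/IH->]; rewrite ?eqxx ?orbT.
have [|i [j [ij Rij]]] := wR (fun n => next (s n)).
  by move=> n; exact: (nextP _ (sP n)).1.
exact: (nextP _ (sP j)).2 (in_s _ _ ij) Rij.
Qed.

(** * Words of exponents, with insertion and multiplication *)

Section Scripts.
Local Open Scope nat_scope.

Definition letter : Type := (nat * nat)%type.
Definition addl (x y : letter) : letter := (x.1 + y.1, x.2 + y.2).

(* A script rewrites a word from left to right: [(true, d)] adds [d] to the next
   letter and [(false, d)] inserts the letter [d]. *)
Definition script : Type := seq (bool * letter).

Fixpoint rewrite_word (s : script) (w : seq letter) : seq letter :=
  match s with
  | [::] => [::]
  | (true, d) :: s' => addl (head (0, 0) w) d :: rewrite_word s' (behead w)
  | (false, d) :: s' => d :: rewrite_word s' w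
  end.

(** The new place of the letter at [k]. Past the letters that [s] reads it continues as a shift,
    hence is strictly increasing on all naturals. *)
Fixpoint script_pos (s : script) (k : nat) : nat :=
  match s with
  | [::] => k
  | (true, _) :: s' => if k is k'.+1 then (script_pos s' k').+1 else 0
  | (false, _) :: s' => (script_pos s' k).+1
  end.

(** The number of letters that [s] reads. On words of this length [rewrite_word] neither uses its
    default letter nor drops anything. *)
Definition script_size (s : script) : nat := count fst s.

Lemma script_pos_mono s : {mono script_pos s : i j / i < j}.
Proof.
elim: s => [|[b d] s IH] i j //=.
by case: b; rewrite ?IH //; case: i j => [|i] [|j] //=; rewrite !ltnS IH.
Qed.

(* A word lists the exponents of two monomials in the same variables, and a
   [mon] moreover marks the positions of two distinguished variables. *)
Definition mon : Type := (nat * nat * seq letter)%type.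

Definition valid (n : nat) (m : mon) : Prop :=
  [/\ m.1.1 < n, m.1.2 < n & size m.2 = n].

Definition act (s : script) (m : mon) : mon :=
  (script_pos s m.1.1, script_pos s m.1.2, rewrite_word s m.2).

Let le4 (x y : letter * letter) :=
  (x.1.1 <= y.1.1 /\ x.1.2 <= y.1.2) /\ (x.2.1 <= y.2.1 /\ x.2.2 <= y.2.2).

(** A skipped letter becomes an insertion and a matched pair becomes the addition of the difference
    of exponents; the second components only record marks and are not rewritten. *)
Lemma embeds_script (u v : seq (letter * letter)) : embeds le4 u v ->
  exists s, [/\ script_size s = size u,
    rewrite_word s (unzip1 u) = unzip1 v &
    forall k, k < size u -> script_pos s k < size v /\
      le4 (nth ((0, 0), (0, 0)) u k) (nth ((0, 0), (0, 0)) v (script_pos s k))].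
Proof.
elim=> {u v} [|y u v _ [s [ss sE sP]]|x y u v xy _ [s [ss sE sP]]].
- by exists [::].
- by exists ((false, y.1) :: s); rewrite /= sE; split=> // k /sP.
exists ((true, (y.1.1 - x.1.1, y.1.2 - x.1.2)) :: s); rewrite /= sE; split.
- by rewrite /script_size /= add1n; congr _.+1.
- congr cons; case: xy => -[h1 h2] _; rewrite /addl /= !subnKC //.
  by case: (y.1).
- by case=> [_|k /sP].
Qed.

(** Higman's lemma is applied to words whose letters carry two bits, telling whether they stand at
    the distinguished positions. *)
Lemma mon_wqo (f : nat -> mon) : (forall t, exists n, valid n (f t)) ->
  exists t t', t < t' /\
    exists2 s, script_size s = size (f t).2 & act s (f t) = f t'.
Proof.
move=> fv.
pose mark (m : mon) : seq (letter * letter) :=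
  mkseq (fun k => (nth (0, 0) m.2 k, (nat_of_bool (k == m.1.1),
                                      nat_of_bool (k == m.1.2)))) (size m.2).
have markE m : unzip1 (mark m) = m.2.
  by rewrite /unzip1 /mark /mkseq -map_comp; exact: mkseq_nth.
have size_mark m : size (mark m) = size m.2 by rewrite size_mkseq.
have wqo4 : monotone_wqo le4.
  have wqo2 := monotone_wqo_prod nat_monotone_wqo nat_monotone_wqo.
  exact: (monotone_wqo_prod wqo2 wqo2).
have [t [t' [tt' /embeds_script[s [ss sE sP]]]]] := higman wqo4 (mark \o f).
exists t, t'; split=> //; exists s; first by rewrite ss size_mark.
rewrite /= !markE !size_mark in sE sP.
have [n [i_n j_n sz_n]] := fv t; rewrite sz_n in sP.
(* The letter at this position has mark 1, so its image has mark at least 1, and only one position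
   of the target has that mark. *)
have pos1 : script_pos s (f t).1.1 = (f t').1.1.
  have [lt_pos] := sP _ i_n; rewrite !nth_mkseq ?sz_n // => -[_ [+ _]] /=.
  by rewrite eqxx lt0b => /eqP.
have pos2 : script_pos s (f t).1.2 = (f t').1.2.
  have [lt_pos] := sP _ j_n; rewrite !nth_mkseq ?sz_n // => -[_ [_ +]] /=.
  by rewrite eqxx lt0b => /eqP.
by rewrite /act pos1 pos2 sE; case: (f t') => -[].
Qed.

(** * The lexicographic order of monomials *)

Fixpoint lexlt (s t : seq nat) : bool :=
  match s, t with
  | x :: s', y :: t' => (x < y) || (x == y) && lexlt s' t'
  | _, _ => false
  end.

Lemma lexlt_trans : transitive lexlt.
Proof.
elim=> [|y t IH] [|x s] [|z u] //= /orP[xy|/andP[/eqP-> st]].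
  by case/orP=> [yz|/andP[/eqP<- _]]; rewrite ?xy ?(ltn_trans xy yz).
case/orP=> [->//|/andP[-> tu]]; by rewrite (IH _ _ st tu) orbT.
Qed.

Lemma lexlt_total s t : size s = size t -> [\/ lexlt s t, s = t | lexlt t s].
Proof.
elim: s t => [|x s IH] [|y t] //=; first by move=> _; exact: Or32.
case=> /IH st; case: (ltngtP x y) => [_|_|->]; [exact: Or31|exact: Or33|].
by case: st => [->|->|->]; [exact: Or31|exact: Or32|exact: Or33].
Qed.

(** The fixed length matters: [[:: 1]], [[:: 0; 1]], [[:: 0; 0; 1]] and so on descend forever. At
    fixed length the induction runs on the head and then on the accessible tail. *)
Lemma lexlt_acc n s : size s = n ->
  Acc (fun s t => size s = n /\ lexlt s t) s.
Proof.
(* The tactic [done] loops on accessibility goals, as it applies [Acc_intro]. *)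
elim: n s => [|n IH] [|x s] sn; try discriminate sn.
  by apply: Acc_intro => t [_]; case: t.
case: sn; elim/ltn_ind: x s => x IHx s sn.
have acc := IH s sn; elim: acc sn => {}s _ IHs sn.
apply: Acc_intro => -[|y t] [tn]; first by [].
case: tn => tn /orP[yx|/andP[/eqP-> ts]]; first exact: IHx.
exact: IHs.
Qed.

Definition code (m : mon) : seq nat :=
  m.1.1 :: m.1.2 :: flatten [seq [:: l.1; l.2] | l <- m.2].

Lemma size_code n m : valid n m -> size (code m) = (n.*2).+2.
Proof.
case=> _ _ <-; rewrite /= size_flatten /shape -map_comp; congr _.+2.
by elim: m.2 => //= l w ->; rewrite doubleS.
Qed.

Lemma code_inj : injective code.
Proof.
case=> [[i j] w] [[i' j'] w'] [-> ->] /= E; congr (_, _).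
by elim: w w' E => [|[a b] w IH] [|[a' b'] w'] //= [-> -> /IH->].
Qed.

Lemma size_rewrite_word s w : size (rewrite_word s w) = size s.
Proof. by elim: s w => [|[[] d] s IH] w //=; rewrite IH. Qed.

Lemma script_pos_lt s k : k < script_size s -> script_pos s k < size s.
Proof.
elim: s k => [|[[] d] s IH] k //=; rewrite /script_size /= ?add1n ?add0n.
  by case: k => // k /IH.
by move/IH.
Qed.

Lemma act_valid s m : valid (script_size s) m -> valid (size s) (act s m).
Proof. by case=> i j _; split; rewrite /= ?script_pos_lt ?size_rewrite_word. Qed.

(** The operations respect the monomial order: [script_pos] is strictly increasing, and the same
    letters are added or inserted at the same places of both words. *)
Lemma act_lexlt s m m' :
  size m.2 = script_size s -> size m'.2 = script_size s ->
  lexlt (code m) (code m') -> lexlt (code (act s m)) (code (act s m')).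
Proof.
case: m m' => [[i j] w] [[i' j'] w'] /=; rewrite !script_pos_mono.
have inj a b : (script_pos s a == script_pos s b) = (a == b).
  by apply/eqP/eqP=> [E|->//]; case: (ltngtP a b) => //;
    rewrite -(script_pos_mono s) E ltnn.
rewrite !inj => sw sw' /orP[->//|/andP[-> /orP[->|/andP[-> lt_w]]]];
  rewrite ?orbT //=; apply/orP; right; apply/orP; right.
elim: s w w' sw sw' lt_w {inj} => [|[[] d] s IH] w w' /=.
- by case: w w' => // -[].
- rewrite /script_size /=; case: w w' => // [a w] [|a' w'] //= [sw] [sw'].
  rewrite !ltn_add2r !eqn_add2r; move=> /orP[->//|/andP[->]].
  by move=> /orP[->|/andP[->] /IH->]; rewrite ?orbT.
- by move=> sw sw' /IH->; rewrite // !eqxx !orbT.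
Qed.

End Scripts.

(** * Reduction by leading monomials *)

Section Span.
Variables (K : fieldType) (V : lmodType K).
Implicit Types (A W : set V) (x y : V).

Lemma submodP W : submod_closed (mem W) <->
  W 0 /\ forall a x y, W x -> W y -> W (a *: x + y).
Proof.
split=> -[W0 WD]; split; first by rewrite inE in W0.
- by move=> a x y Wx Wy; have := WD a x y; rewrite !inE; apply.
- by rewrite inE.
- by move=> a x y; rewrite !inE; exact: WD.
Qed.

Section Closure.
Variable W : set V.
Hypothesis Wsub : submod_closed (mem W).

Lemma submod0 : W 0. Proof. by case/submodP: Wsub. Qed.

Lemma submodZD a x y : W x -> W y -> W (a *: x + y).
Proof. by case/submodP: Wsub => _; apply. Qed.

Lemma submodD x y : W x -> W y -> W (x + y).
Proof. by rewrite -{2}[x]scale1r; exact: submodZD. Qed.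

Lemma submodZ a x : W x -> W (a *: x).
Proof.
by move=> Wx; rewrite -[_ *: _]addr0; apply: submodZD => //; exact: submod0.
Qed.

Lemma submodN x : W x -> W (- x).
Proof. by rewrite -scaleN1r; exact: submodZ. Qed.

Lemma submodB x y : W x -> W y -> W (x - y).
Proof. by move=> Wx /submodN; exact: submodD. Qed.

Lemma submod_cong x y : W (x - y) -> W y -> W x.
Proof. by move=> Wxy Wy; rewrite -(subrK y x); exact: submodD. Qed.

Lemma submod_sum (I : Type) (r : seq I) (F : I -> V) :
  (forall i, W (F i)) -> W (\sum_(i <- r) F i).
Proof.
by move=> WF; apply: big_ind => // [|x y]; [exact: submod0|exact: submodD].
Qed.

End Closure.

Lemma subset_span A : A `<=` span A. Proof. exact: sub_gen_smallest. Qed.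

Lemma span_min A W : submod_closed (mem W) -> A `<=` W -> span A `<=` W.
Proof. by move=> Wsub AW; exact: smallest_sub. Qed.

Lemma span_submod A : submod_closed (mem (span A)).
Proof.
apply: (submodP _).2; split=> [W [Wsub _]|a x y Ax Ay W Wsub]; first exact: submod0.
by case: (Wsub) => Wsub' _; apply: submodZD => //; [exact: Ax|exact: Ay].
Qed.

Lemma span_mono A W : A `<=` W -> span A `<=` span W.
Proof.
by move=> AW; apply: span_min (span_submod _) _ => x /AW; exact: subset_span.
Qed.

End Span.

Section LinearSpan.
Variables (K : fieldType) (U V : lmodType K) (phi : U -> V) (W : set V).
Hypothesis phiL : linear phi.

Lemma linear_map0 : phi 0 = 0.
Proof. by have := phiL (-1) 0 0; rewrite scaler0 addr0 scaleN1r addNr. Qed.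

Lemma linear_mapD x y : phi (x + y) = phi x + phi y.
Proof. by have := phiL 1 x y; rewrite !scale1r. Qed.

Lemma linear_mapZ a x : phi (a *: x) = a *: phi x.
Proof. by have := phiL a x 0; rewrite linear_map0 !addr0. Qed.

Lemma linear_mapN x : phi (- x) = - phi x.
Proof. by rewrite -scaleN1r linear_mapZ scaleN1r. Qed.

Lemma linear_mapB x y : phi (x - y) = phi x - phi y.
Proof. by rewrite linear_mapD linear_mapN. Qed.

Lemma submod_preimage : submod_closed (mem W) -> submod_closed (mem (phi @^-1` W)).
Proof.
move=> Wsub; apply: (submodP _).2; split=> [|a x y Wx Wy] /=.
  by rewrite linear_map0; exact: submod0.
by rewrite phiL; exact: submodZD.
Qed.

Lemma span_image (B : set U) : submod_closed (mem W) ->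
  (forall x, B x -> W (phi x)) -> forall x, span B x -> W (phi x).
Proof. by move=> /submod_preimage preW BW x; apply: (span_min preW). Qed.

End LinearSpan.

(** * Leading monomials in an abstract family *)

Section LeadingTerms.
Variables (K : fieldType) (L : lmodType K) (E : mon -> L) (N : set L).
(** In the application [N] is the set of identities and [closed] singles out the T-ideals that
    contain them. The family [E] may have linear relations. *)
Variable closed : set L -> Prop.

Hypothesis closed_submod : forall T, closed T -> submod_closed (mem T).
Hypothesis closedN : closed N.
Hypothesis sub_closed : forall T, closed T -> N `<=` T.
Hypothesis E_pad : forall i j w k, E (i, j, w ++ nseq k (0, 0)%N) = E (i, j, w).
Hypothesis scriptE : forall s, exists Phi : L -> L,
  [/\ linear Phi, forall T, closed T -> forall x, T x -> T (Phi x) &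
      forall m, valid (script_size s) m -> N (Phi (E m) - E (act s m))].

Let mons (P : mon -> Prop) : set L := span (N `|` [set E m | m in P]).
Let lower n m m' := valid n m' /\ lexlt (code m') (code m).
Let upto n m m' := valid n m' /\ (m' = m \/ lexlt (code m') (code m)).

Let sub_mons P : N `<=` mons P.
Proof. by move=> x Nx; apply: subset_span; left. Qed.

Let mem_mons (P : mon -> Prop) m : P m -> mons P (E m).
Proof. by move=> Pm; apply: subset_span; right; exists m. Qed.

Let monsS (P Q : mon -> Prop) : (forall m, P m -> Q m) -> mons P `<=` mons Q.
Proof.
by move=> PQ; apply: span_mono => x [Nx|[m /PQ Qm <-]]; [left|right; exists m].
Qed.

Let mons_ind (P : mon -> Prop) W : submod_closed (mem W) -> N `<=` W ->
  (forall m, P m -> W (E m)) -> mons P `<=` W.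
Proof. by move=> Ws NW PW; apply: span_min => // x [/NW|[m /PW Wm <-]]. Qed.

(** Finitely many monomials of equal length have a largest one, as the order on codes is total; the
    alternative [N x] covers combinations without monomials. *)
Let mons_bounded n (P : mon -> Prop) x : mons (fun m => valid n m /\ P m) x ->
  N x \/ exists m, [/\ valid n m, P m & mons (upto n m) x].
Proof.
have Nsub := closed_submod closedN.
pose W := [set x | N x \/ exists m, [/\ valid n m, P m & mons (upto n m) x]].
apply: (@mons_ind _ W) => [|y Ny|m [vm Pm]]; last 2 first.
- by left.
- by right; exists m; split=> //; apply: mem_mons; split=> //; left.
have upto_trans m m' : valid n m -> valid n m' ->
    m = m' \/ lexlt (code m) (code m') -> mons (upto n m) `<=` mons (upto n m').
  move=> vm vm' mm'; apply: monsS => m'' [vm'' le_m]; split=> //.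
  case: mm' => [<-//|lt_m]; case: le_m => [->|lt_m'']; right=> //.
  exact: lexlt_trans lt_m'' lt_m.
apply: (submodP _).2; split=> [|a y z]; first by left; exact: (submod0 Nsub).
have up m := span_submod (N `|` [set E m' | m' in upto n m]).
case=> [Ny|[m [vm Pm my]]] [Nz|[m' [vm' Pm' mz]]].
- by left; exact: submodZD.
- right; exists m'; split=> //; apply: (submodZD (up _)) => //.
  exact: sub_mons.
- right; exists m; split=> //; apply: (submodZD (up _)) => //.
  exact: sub_mons.
right; have szE : size (code m) = size (code m').
  by rewrite (size_code vm) (size_code vm').
have [lt_m|/code_inj eq_m|lt_m] := lexlt_total szE.
- exists m'; split=> //; apply: (submodZD (up _)) => //.
  by apply: upto_trans my => //; right.
- by exists m'; split=> //; apply: (submodZD (up _)); rewrite // -eq_m.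
- exists m; split=> //; apply: (submodZD (up _)) => //.
  by apply: upto_trans mz => //; right.
Qed.

Let mons_valid x : mons (fun=> True) x -> exists n, mons (valid n) x.
Proof.
(* All larger lengths are allowed, since padding with zero exponents changes nothing; so two
   elements always have a common length. *)
pose W := [set x | exists n, forall n', (n <= n')%N -> mons (valid n') x].
suff sub : mons (fun=> True) `<=` W.
  by move=> /sub[n xn]; exists n; exact: xn.
have mons_sub P := span_submod (N `|` [set E m | m in P]).
apply: mons_ind => [|y Ny|[[i j] w] _]; last 2 first.
- by exists 0%N => n _; exact: sub_mons.
- exists (maxn (size w) (maxn i j).+1) => n le_n.
  rewrite -(E_pad _ _ _ (n - size w)); apply: mem_mons.
  by split; rewrite /= ?size_cat ?size_nseq; lia.
apply: (submodP _).2; split=> [|a y z [n yn] [n' zn']].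
  by exists 0%N => n _; exact: (submod0 (mons_sub _)).
exists (maxn n n') => k; rewrite geq_max => /andP[nk n'k].
by apply: (submodZD (mons_sub _)); [exact: yn|exact: zn'].
Qed.

(** [S] holds one element of [J] for each member of a finite basis of the leading monomials. Any
    element of [J] in the span is then reduced to lower ones by subtracting images of elements of
    [S]. *)
Lemma leading_term_basis (J : set L) : closed J ->
  exists S : seq L, (forall x, x \in S -> J x) /\
    forall T, closed T -> (forall x, x \in S -> T x) ->
    forall x, J x -> span (N `|` range E) x -> T x.
Proof.
move=> closedJ.
have mons_sub P := span_submod (N `|` [set E m | m in P]).
pose leads m F := J F /\ mons (lower (size m.2) m) (F - E m).
pose P m := valid (size m.2) m /\ exists F, leads m F.
have [|s [sP s_basis]] := @wqo_finite_basis mon P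
  (fun m m' => exists2 s, script_size s = size m.2 & act s m = m').
  by move=> f fP; apply: mon_wqo => t; exists (size (f t).2); case: (fP t).
have exF m : exists F, P m -> leads m F.
  by have [[_ [F mF]]|nP] := pselect (P m); [exists F|exists 0].
have [F FP] := choice exF.
exists [seq F m | m <- s]; split=> [_ /mapP[m /sP/FP[JF _] ->]//|].
move=> T closedT ST x Jx x_E.
have Jsub := closed_submod closedJ; have Tsub := closed_submod closedT.
have {x_E} [n x_n] : exists n, mons (valid n) x by exact: mons_valid.
(* The induction is on an upper bound [m] for the monomials of [x]. *)
suff below m : valid n m -> forall x, J x -> mons (upto n m) x -> T x.
  have : mons (fun m => valid n m /\ True) x.
    by apply: monsS x_n => m.
  move=> /mons_bounded[/(sub_closed closedT)//|[m [vm _ mx]]].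
  exact: below mx.
move=> {x Jx x_n} vm.
have acc := lexlt_acc (size_code vm).
move: acc vm; move Dc: (code m) => c acc.
elim: acc m Dc => {}c _ IH m Dc vm.
have szm : size m.2 = n by case: vm.
have lowT x : J x -> mons (lower n m) x -> T x.
  move=> Jx /mons_bounded[/(sub_closed closedT)//|[m' [vm' lt_m' m'x]]].
  apply: (IH (code m')) Jx m'x => //; split; first exact: size_code.
  by rewrite -Dc.
move=> x Jx mx.
(* Here [a] is a coefficient of [E m] in some expression of [x]. It need not be unique: either it is
   0 and the bound drops, or [m] is a leading monomial of [J]. *)
have [a ax] : exists a, mons (lower n m) (x - a *: E m).
  move: {Jx} x mx; apply: (@mons_ind (upto n m)
      [set x | exists a, mons (lower n m) (x - a *: E m)]) => /=.
  - apply: (submodP _).2; split=> [|b y z [a ya] [a' za']].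
      by exists 0; rewrite scale0r subr0; exact: (submod0 (mons_sub _)).
    exists (b * a + a'); rewrite scalerDl -scalerA opprD addrACA -scalerBr.
    exact: (submodZD (mons_sub _)).
  - by move=> y Ny; exists 0; rewrite scale0r subr0; exact: sub_mons.
  - move=> m' [vm' [->|lt_m]].
      by exists 1; rewrite scale1r subrr; exact: (submod0 (mons_sub _)).
    by exists 0; rewrite scale0r subr0; exact: mem_mons.
have [a0|a_neq0] := eqVneq a 0.
  by apply: lowT => //; move: ax; rewrite a0 scale0r subr0.
have Pm : P m.
  rewrite /P szm; split=> //; exists (a^-1 *: x); rewrite /leads szm; split.
    exact: (submodZ Jsub).
  by rewrite -[E m](scalerK a_neq0) -scalerBr; exact: (submodZ (mons_sub _)).
have [m0 m0s [sc sz_sc act_m]] := s_basis _ Pm.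
have [vm0 _] := sP _ m0s; have [JF0 F0m0] := FP _ (sP _ m0s).
have [Phi [PhiL PhiT PhiE]] := scriptE sc.
(* The image of [F m0] under the script has leading monomial [m], because [act sc] keeps the lower
   terms lower. *)
have lowF : mons (lower n m) (Phi (F m0) - E m).
  have -> : Phi (F m0) - E m = Phi (F m0 - E m0) + (Phi (E m0) - E (act sc m0)).
    by rewrite (linear_mapB PhiL) act_m addrA subrK.
  have PhiEm0 : mons (lower n m) (Phi (E m0) - E (act sc m0)).
    by apply: sub_mons; apply: PhiE; rewrite sz_sc.
  apply: (submodD (mons_sub _)) => //.
  apply: (span_image PhiL) F0m0 => // y [Ny|[m' [vm' lt_m'] <-]].
    by apply: sub_mons; apply: PhiT.
  apply: (submod_cong (mons_sub _)).
    by apply: sub_mons; apply: PhiE; rewrite sz_sc.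
  apply: mem_mons; split.
    have -> : n = size sc by rewrite -szm -act_m size_rewrite_word.
    by apply: act_valid; rewrite sz_sc.
  by rewrite -act_m; apply: act_lexlt => //; case: vm' => _ _ ->.
have -> : x = (x - a *: Phi (F m0)) + a *: Phi (F m0) by rewrite subrK.
apply: (submodD Tsub); last first.
  by apply: (submodZ Tsub); apply: PhiT => //; apply/ST/map_f.
apply: lowT.
  by apply: (submodB Jsub) => //; apply: (submodZ Jsub); apply: PhiT.
have -> : x - a *: Phi (F m0) = (x - a *: E m) - a *: (Phi (F m0) - E m).
  by rewrite scalerBr opprB addrA subrK.
by apply: (submodB (mons_sub _)) => //; apply: (submodZ (mons_sub _)).
Qed.

End LeadingTerms.

(** * Brackets in UT3 *)

Section LieTheory.
Variables (K : fieldType) (L : lieAlgType K).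
Implicit Types (x y z : L) (Y : nat -> L) (c : nat -> K) (a : seq nat).

Lemma lieb0l x : lieb 0 x = 0 :> L.
Proof. exact: (linear_map0 (lieb_linearl x)). Qed.

Lemma lieb0r x : lieb x 0 = 0 :> L.
Proof. exact: (linear_map0 (lieb_linearr x)). Qed.

Lemma liebDl x y z : lieb (x + y) z = lieb x z + lieb y z :> L.
Proof. exact: (linear_mapD (lieb_linearl z)). Qed.

Lemma liebDr x y z : lieb x (y + z) = lieb x y + lieb x z :> L.
Proof. exact: (linear_mapD (lieb_linearr x)). Qed.

Lemma liebNr x y : lieb x (- y) = - lieb x y :> L.
Proof. exact: (linear_mapN (lieb_linearr x)). Qed.

Lemma liebZl k x y : lieb (k *: x) y = k *: lieb x y :> L.
Proof. exact: (linear_mapZ (lieb_linearl y)). Qed.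

Lemma liebZr k x y : lieb x (k *: y) = k *: lieb x y :> L.
Proof. exact: (linear_mapZ (lieb_linearr x)). Qed.

Lemma liebC x y : lieb x y = - lieb y x :> L.
Proof.
apply/eqP; rewrite -addr_eq0; have := liebxx (x + y).
by rewrite liebDl !liebDr !liebxx add0r addr0 => ->.
Qed.

Lemma lieb_leibniz x y z :
  lieb x (lieb y z) = lieb (lieb x y) z + lieb y (lieb x z) :> L.
Proof.
apply/eqP; rewrite -subr_eq0 opprD addrA -(lieb_jacobi x y z) [lieb z x]liebC.
by rewrite (liebC z) liebNr addrAC.
Qed.

(** The operator y^a, with the adjoint maps, which need not commute, in a fixed order: the last
    variable acts first. *)
Fixpoint ad_word Y a x : L :=
  if a is n :: a' then iter n (lieb (Y 0%N)) (ad_word (Y \o succn) a' x) else x.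

Lemma ad_word0 Y a : ad_word Y a 0 = 0.
Proof.
by elim: a Y => //= n a IH Y; rewrite IH; elim: n => //= n ->; rewrite lieb0r.
Qed.

Lemma ad_word_pad Y a k x : ad_word Y (a ++ nseq k 0%N) x = ad_word Y a x.
Proof.
elim: a Y => [|n a IH] Y /=; last by rewrite IH.
by elim: k Y => //= k IH Y; rewrite IH.
Qed.

Lemma ad_word_ind (W : set L) Y a x :
  (forall k z, W z -> W (lieb (Y k) z)) -> W x -> W (ad_word Y a x).
Proof.
elim: a Y => //= n a IH Y YW Wx; elim: n => [|n IHn] /=; last exact: YW.
by apply: IH => // k; exact: YW.
Qed.

Lemma ad_word_linear Y a : linear (ad_word Y a).
Proof.
elim: a Y => //= n a IH Y k x z; rewrite IH; elim: n => //= n ->.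
by rewrite liebDr liebZr.
Qed.

Fixpoint word_eval c a : K :=
  if a is n :: a' then c 0%N ^+ n * word_eval (c \o succn) a' else 1.

Lemma ad_word_eigen Y c a x : (forall k, lieb (Y k) x = c k *: x) ->
  ad_word Y a x = word_eval c a *: x.
Proof.
elim: a Y c => [|n a IH] Y c Yx /=; first by rewrite scale1r.
rewrite (IH _ (c \o succn)) => [|k]; last exact: Yx.
elim: n => [|n IHn] /=; first by rewrite mul1r.
by rewrite IHn liebZr Yx !scalerA exprS mulrC mulrA.
Qed.

Lemma word_eval_incr c a k : word_eval c (incr_nth a k) = c k * word_eval c a.
Proof.
elim: a k c => [|n a IH] [|k] c //=; rewrite ?mulr1 ?expr1 ?exprS ?mulrA //.
  by rewrite mul1r; elim: k c => [|k IH] c //=; rewrite ?mulr1 ?expr1 // mul1r IH.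
by rewrite IH /= mulrCA mulrA.
Qed.

(** Letters of [w] move along [script_pos], and every letter of [s], added or inserted, contributes
    a factor at its own place: rewriting is renaming followed by multiplication by a monomial. *)
Lemma word_eval_script (p : letter -> nat) c s w :
  {morph p : x y / addl x y >-> (x + y)%N} -> size w = script_size s ->
  word_eval (c \o script_pos s) (map p w) * word_eval c (map p (map snd s))
  = word_eval c (map p (rewrite_word s w)).
Proof.
move=> pD; elim: s w c => [|[[] d] s IH] w c /=.
- by move/size0nil->; rewrite mulr1.
- rewrite /script_size /=; case: w => //= l w [sw].
  by rewrite pD exprD -(IH _ _ sw) mulrACA.
- by move=> sw; rewrite mulrCA; congr (_ * _); rewrite -IH.
Qed.

End LieTheory.

Lemma lie_hom_ad_word (K : fieldType) (L M : lieAlgType K) (phi : L -> M) Y a x :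
  lie_hom phi -> phi (ad_word Y a x) = ad_word (phi \o Y) a (phi x).
Proof.
case=> _ phiB; elim: a Y => //= n a IH Y.
by rewrite -[in RHS]IH; elim: n => //= n IHn; rewrite phiB IHn.
Qed.

(** * Brackets of homogeneous upper triangular matrices *)

Section UT3Brackets.
Variable K : fieldType.
Implicit Types A B : UT3 K.

Let o1 : 'I_3 := lift ord0 ord0.
Let o2 : 'I_3 := lift ord0 (lift ord0 ord0).

Lemma ord3P (i : 'I_3) : [\/ i = ord0, i = o1 | i = o2].
Proof.
case: i => -[|[|[|//]]] hi; [apply: Or31|apply: Or32|apply: Or33]; exact: val_inj.
Qed.

Let lower A (i j : 'I_3) : (j < i)%N -> A i j = 0.
Proof. exact: (upper_trigP _ (ut3_mxP A)). Qed.

Lemma ut3_eq A B :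
  A ord0 ord0 = B ord0 ord0 -> A o1 o1 = B o1 o1 -> A o2 o2 = B o2 o2 ->
  A ord0 o1 = B ord0 o1 -> A o1 o2 = B o1 o2 -> A ord0 o2 = B ord0 o2 -> A = B.
Proof.
move=> *; apply: val_inj; apply/matrixP => i j /=.
by case: (ord3P i) => ->; case: (ord3P j) => -> //; rewrite !lower.
Qed.

Lemma ut3_liebE A B (i j : 'I_3) : lieb A B i j =
  (A i ord0 * B ord0 j - B i ord0 * A ord0 j) +
  ((A i o1 * B o1 j - B i o1 * A o1 j) + (A i o2 * B o2 j - B i o2 * A o2 j)).
Proof. by rewrite /= !mxE -sumrB !big_ord_recl big_ord0 addr0. Qed.

Let lowerE A : (A o1 ord0 = 0) * (A o2 ord0 = 0) * (A o2 o1 = 0).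
Proof. by rewrite !lower. Qed.

(** As e_13 has degree g g^-1 = 1, a matrix of degree 1 is a diagonal one plus a multiple of
    e_13. *)
Definition ut3_deg1 A : Prop := A ord0 o1 = 0 /\ A o1 o2 = 0.

Let diag0 A := [/\ A ord0 ord0 = 0, A o1 o1 = 0 & A o2 o2 = 0].

Definition ut3_e12 A : Prop := [/\ diag0 A, A o1 o2 = 0 & A ord0 o2 = 0].
Definition ut3_e23 A : Prop := [/\ diag0 A, A ord0 o1 = 0 & A ord0 o2 = 0].
Definition ut3_e13 A : Prop := [/\ diag0 A, A ord0 o1 = 0 & A o1 o2 = 0].

Ltac ut3_entries :=
  move=> *;
  repeat match goal with
  | H : ut3_deg1 _ |- _ => case: H => ? ?
  | H : ut3_e12 _ |- _ => case: H => -[? ? ?] ? ?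
  | H : ut3_e23 _ |- _ => case: H => -[? ? ?] ? ?
  | H : ut3_e13 _ |- _ => case: H => -[? ? ?] ? ?
  end;
  apply: ut3_eq; rewrite ?ut3_liebE /= ?mxE ?lowerE;
  repeat match goal with H : _ = 0 |- _ => rewrite ?H; clear H end; ring.

(** The e_13 part of [Y] commutes with e_12, so only the diagonal acts. The next two lemmas hold for
    the same reason. *)
Lemma ut3_YZ Y Z : ut3_deg1 Y -> ut3_e12 Z ->
  lieb Y Z = (Y ord0 ord0 - Y o1 o1) *: Z.
Proof. ut3_entries. Qed.

Lemma ut3_YW Y W : ut3_deg1 Y -> ut3_e23 W ->
  lieb Y W = (Y o1 o1 - Y o2 o2) *: W.
Proof. ut3_entries. Qed.

Lemma ut3_YE Y E : ut3_deg1 Y -> ut3_e13 E ->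
  lieb Y E = (Y ord0 ord0 - Y o2 o2) *: E.
Proof. ut3_entries. Qed.

Lemma ut3_ZZ Z Z' : ut3_e12 Z -> ut3_e12 Z' -> lieb Z Z' = 0.
Proof. ut3_entries. Qed.

Lemma ut3_WW W W' : ut3_e23 W -> ut3_e23 W' -> lieb W W' = 0.
Proof. ut3_entries. Qed.

Lemma ut3_ZE Z E : ut3_e12 Z -> ut3_e13 E -> lieb Z E = 0.
Proof. ut3_entries. Qed.

Lemma ut3_WE W E : ut3_e23 W -> ut3_e13 E -> lieb W E = 0.
Proof. ut3_entries. Qed.

Lemma ut3_ZW_e13 Z W : ut3_e12 Z -> ut3_e23 W -> ut3_e13 (lieb Z W).
Proof.
case=> -[z0 z1 z2] z12 z02 [[w0 w1 w2] w01 w02].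
by split; [split|..];
  rewrite ut3_liebE ?z0 ?z1 ?z2 ?z12 ?z02 ?w0 ?w1 ?w2 ?w01 ?w02 !lowerE; ring.
Qed.

Lemma ut3_YY_e13 Y Y' : ut3_deg1 Y -> ut3_deg1 Y' -> ut3_e13 (lieb Y Y').
Proof.
case=> y01 y12 [y01' y12'].
by split; [split|..]; rewrite ut3_liebE ?y01 ?y12 ?y01' ?y12' !lowerE; ring.
Qed.

Section GammaShape.
Variables (G : groupType) (g : G).
Hypothesis g2 : (g ^+ 2)%g <> 1%g.

Let g_neq1 : g <> 1%g.
Proof. by move=> g1; apply: g2; rewrite g1 expg1n. Qed.

Let gV_neq1 : (g^-1)%g <> 1%g.
Proof. by move=> g1; apply: g_neq1; rewrite -[g]invgK g1 invg1. Qed.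

(** This separates e_12 from e_23; with the two facts above, the degrees 1, g and g^-1 are pairwise
    distinct. *)
Let g_neqV : g <> (g^-1)%g.
Proof. by move=> gE; apply: g2; rewrite expgS expg1 {2}gE mulgV. Qed.

Lemma Gamma_entry d A (i j : 'I_3) :
  Gamma K g (g^-1)%g d A -> ut3_deg g (g^-1)%g i j <> d -> A i j = 0.
Proof.
move=> dA ij_d; move: A dA; apply: span_min.
  apply: (submodP _).2; split=> [|a A B /= A0 B0]; first by rewrite /= mxE.
  by rewrite !mxE A0 B0 mulr0 addr0.
move=> E [k [l [kl_d /= ->]]]; rewrite mxE.
by case: eqP => //= ik; case: eqP => // jl; case: ij_d; rewrite ik jl.
Qed.

Lemma Gamma_deg1 A : Gamma K g (g^-1)%g 1%g A -> ut3_deg1 A.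
Proof. by move=> dA; split; apply: Gamma_entry dA _. Qed.

Lemma Gamma_e12 A : Gamma K g (g^-1)%g g A -> ut3_e12 A.
Proof.
move=> dA; split; [split|..]; apply: Gamma_entry dA _; rewrite /ut3_deg /= ?mulgV;
  by [exact/nesym|exact/nesym/g_neqV].
Qed.

Lemma Gamma_e23 A : Gamma K g (g^-1)%g (g^-1)%g A -> ut3_e23 A.
Proof.
move=> dA; split; [split|..]; apply: Gamma_entry dA _; rewrite /ut3_deg /= ?mulgV;
  by [exact/nesym|exact: g_neqV].
Qed.

Lemma Gamma_other d A : d <> 1%g -> d <> g -> d <> (g^-1)%g ->
  Gamma K g (g^-1)%g d A -> A = 0.
Proof.
move=> d1 dg dgV dA; apply: ut3_eq; rewrite [RHS]mxE; apply: Gamma_entry dA _;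
  by rewrite /ut3_deg /= ?mulgV; exact/nesym.
Qed.

End GammaShape.

End UT3Brackets.

(** * The relatively free algebra *)

Lemma lie_hom_comp (K : fieldType) (L M P : lieAlgType K) (psi : M -> P)
    (phi : L -> M) : lie_hom psi -> lie_hom phi -> lie_hom (psi \o phi).
Proof.
move=> [psiL psiB] [phiL phiB]; split=> [a x y|x y] /=; first by rewrite phiL psiL.
by rewrite phiB psiB.
Qed.

Lemma graded_hom_comp (G : Type) (K : fieldType) (L M P : lieAlgType K)
    (gL : G -> set L) (gM : G -> set M) (gP : G -> set P)
    (psi : M -> P) (phi : L -> M) :
  graded_hom gM gP psi -> graded_hom gL gM phi -> graded_hom gL gP (psi \o phi).
Proof.
move=> [psi_hom psi_gr] [phi_hom phi_gr]; split; first exact: lie_hom_comp.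
by move=> d x /phi_gr/psi_gr.
Qed.

(** The adjoint map of a bracket is the commutator of the adjoint maps, so stability under the
    adjoint maps of generators gives stability under all of them. *)
Lemma free_ad_ind (K : fieldType) (X : Type) (W : set (freeLie K X)) :
  submod_closed (mem W) -> (forall v, W (free_gen K v)) ->
  (forall v x, W x -> W (lieb (free_gen K v) x)) -> forall x, W x.
Proof.
move=> Wsub Wgen Wad.
have Wbr u x : W x -> W (lieb u x).
  rewrite -(free_reprK u).
  elim: (free_repr u) x => [v||s IH|s IHs t IHt|a s IH|s IHs t IHt] x Wx.
  - exact: Wad.
  - by rewrite lieb0l; exact: (submod0 Wsub).
  - by rewrite free_classN liebC liebNr -liebC; apply: (submodN Wsub); exact: IH.
  - by rewrite free_classD liebDl; apply: (submodD Wsub); [exact: IHs|exact: IHt].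
  - by rewrite free_classZ liebZl; apply: (submodZ Wsub); exact: IH.
  rewrite free_classB; set u' := free_class s; set v := free_class t.
  rewrite -[X in W X](addrK (lieb v (lieb u' x))).
  rewrite -lieb_leibniz; apply: (submodB Wsub); [exact/IHs/IHt|exact/IHt/IHs].
move=> x; rewrite -(free_reprK x).
elim: (free_repr x) => [v||s IH|s IHs t IHt|a s IH|s IHs t IHt].
- exact: Wgen.
- exact: (submod0 Wsub).
- by rewrite free_classN; exact: (submodN Wsub).
- by rewrite free_classD; exact: (submodD Wsub).
- by rewrite free_classZ; exact: (submodZ Wsub).
- by rewrite free_classB; exact: Wbr.
Qed.

Lemma linear_sub (K : fieldType) (U V : lmodType K) (f h : U -> V) :
  linear f -> linear h -> linear (fun x => f x - h x).
Proof. by move=> fL hL a x y; rewrite fL hL scalerBr opprD addrACA. Qed.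

Section FreeGrading.
Variables (K : fieldType) (G : groupType).
Local Notation L := (freeGLie K G).
Local Notation grading := (@free_grading K G).

Lemma grading_gen i d : grading d (free_gen K (i, d)).
Proof. by apply: subset_span; exact: lie_monomial_var. Qed.

Lemma grading_lieb d e (x y : L) :
  grading d x -> grading e y -> grading (d * e)%g (lieb x y).
Proof.
have gr_sub f : submod_closed (mem (grading f)) by exact: span_submod.
move=> dx ey; apply: (span_image (lieb_linearl y)) dx; first exact: gr_sub.
move=> u du; apply: (span_image (lieb_linearr u)) ey; first exact: gr_sub.
by move=> v ev; apply: subset_span; exact: lie_monomial_br.
Qed.

Lemma graded_free_lift (f : nat * G -> L) : (forall v, grading v.2 (f v)) ->
  graded_hom grading grading (free_lift f).
Proof.
move=> fgr; have [liftL liftB] := free_lift_hom f; split=> // d.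
apply: span_image => //; first exact: span_submod.
move=> x; elim=> {d x} [i d|d e u v _ du _ ev].
  by rewrite free_lift_gen; exact: (fgr (i, d)).
by rewrite liftB; exact: grading_lieb.
Qed.

Section GradedIdentities.
Variables (M : lieAlgType K) (gM : G -> set M).

Lemma graded_identitiesP (x y : L) :
  (forall phi : L -> M, graded_hom grading gM phi -> phi x = phi y) ->
  graded_identities gM (x - y).
Proof.
by move=> xy phi [[phiL phiB] phig]; rewrite (linear_mapB phiL) xy ?subrr.
Qed.

Lemma graded_identities_T_ideal : T_ideal (graded_identities gM).
Proof.
split; last first.
  by move=> psi psig f fId phi phig; exact: fId (graded_hom_comp phig psig).
split.
  apply: (submodP _).2; split=> [phi [[phiL _] _]|a x y Ix Iy phi phig].
    exact: (linear_map0 phiL).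
  by have [[phiL _] _] := phig; rewrite phiL Ix // Iy // scaler0 addr0.
by move=> x y Iy phi phig; have [[_ phiB] _] := phig; rewrite phiB Iy // lieb0r.
Qed.

End GradedIdentities.

Lemma T_ideal_gen_T_ideal (S : set L) : T_ideal (T_ideal_gen S).
Proof.
split; last first.
  by move=> phi phig f Sf T [TT ST]; apply: TT.2 => //; exact: Sf.
split.
  apply: (submodP _).2; split=> [T [[[Tsub _] _] _]|a x y Sx Sy T TS].
    exact: (submod0 Tsub).
  by have [[[Tsub _] _] _] := TS; apply: (submodZD Tsub); [exact: Sx|exact: Sy].
by move=> x y Sy T TS; have [[[_ Tad] _] _] := TS; apply: Tad; exact: Sy.
Qed.

Lemma T_ideal_add (I J : set L) : T_ideal I -> T_ideal J ->
  T_ideal [set x + y | x in I & y in J].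
Proof.
move=> [[Isub Iad] Iend] [[Jsub Jad] Jend]; split; last first.
  move=> phi phig _ [x Ix [y Jy <-]]; exists (phi x); first exact: Iend.
  exists (phi y); first exact: Jend.
  by have [[phiL _] _] := phig; rewrite (linear_mapD phiL).
split.
  apply: (submodP _).2; split=> [|a _ _ [x Ix [y Jy <-]] [x' Ix' [y' Jy' <-]]].
    exists 0; first exact: (submod0 Isub).
    by exists 0; [exact: (submod0 Jsub)|rewrite addr0].
  exists (a *: x + x'); first exact: (submodZD Isub).
  exists (a *: y + y'); first exact: (submodZD Jsub).
  by rewrite scalerDr addrACA.
move=> u _ [x Ix [y Jy <-]]; exists (lieb u x); first exact: Iad.
by exists (lieb u y); [exact: Jad|rewrite liebDr].
Qed.

End FreeGrading.

(** * Normal forms modulo the identities *)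

Section NormalForms.
Variables (G : groupType) (g : G) (K : fieldType).
Hypothesis g2 : (g ^+ 2)%g <> 1%g.

Local Notation L := (freeGLie K G).
Local Notation grading := (@free_grading K G).
Local Notation Gam := (Gamma K g (g^-1)%g).
Local Notation Id := (graded_identities Gam).

Let y i : L := free_gen K (i, 1%g).
Let z i : L := free_gen K (i, g).
Let w i : L := free_gen K (i, (g^-1)%g).

Let IdT : T_ideal Id. Proof. exact: graded_identities_T_ideal. Qed.
Let Idsub : submod_closed (mem Id). Proof. by case: IdT => -[]. Qed.
Let Idad x u : Id u -> Id (lieb x u). Proof. by case: IdT => -[_ +] _; apply. Qed.

Section Values.
Variable phi : L -> UT3 K.
Hypothesis phig : graded_hom grading Gam phi.

Let phi_hom : lie_hom phi. Proof. by case: phig. Qed.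
Lemma val_y_deg1 i : ut3_deg1 (phi (y i)).
Proof. by apply: (Gamma_deg1 g2); apply: phig.2; exact: grading_gen. Qed.
Let phi_z i : ut3_e12 (phi (z i)).
Proof. by apply: (Gamma_e12 g2); apply: phig.2; exact: grading_gen. Qed.
Let phi_w i : ut3_e23 (phi (w i)).
Proof. by apply: (Gamma_e23 g2); apply: phig.2; exact: grading_gen. Qed.

Let entry (i j : 'I_3) k : K := phi (y k) i i - phi (y k) j j.
(** The eigenvalues of the adjoint map of [phi (y k)] on e_12, e_23 and e_13; thus [gamma] is the
    sum of [alpha] and [beta]. *)
Definition alpha := entry ord0 (lift ord0 ord0).
Definition beta := entry (lift ord0 ord0) (lift ord0 (lift ord0 ord0)).
Definition gamma := entry ord0 (lift ord0 (lift ord0 ord0)).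

Lemma val_z a i : phi (ad_word y a (z i)) = word_eval alpha a *: phi (z i).
Proof.
rewrite lie_hom_ad_word //; apply: ad_word_eigen => k.
exact: ut3_YZ (val_y_deg1 k) (phi_z i).
Qed.

Lemma val_w b j : phi (ad_word y b (w j)) = word_eval beta b *: phi (w j).
Proof.
rewrite lie_hom_ad_word //; apply: ad_word_eigen => k.
exact: ut3_YW (val_y_deg1 k) (phi_w j).
Qed.

Lemma val_zw a i b j : phi (lieb (ad_word y a (z i)) (ad_word y b (w j))) =
  (word_eval alpha a * word_eval beta b) *: lieb (phi (z i)) (phi (w j)).
Proof. by rewrite phi_hom.2 val_z val_w liebZl liebZr scalerA. Qed.

Lemma val_yy a i j : phi (ad_word y a (lieb (y i) (y j))) =
  word_eval gamma a *: lieb (phi (y i)) (phi (y j)).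
Proof.
rewrite lie_hom_ad_word // phi_hom.2; apply: ad_word_eigen => k.
by apply: ut3_YE; [exact: val_y_deg1|apply: ut3_YY_e13; exact: val_y_deg1].
Qed.

Lemma val_y_z k a i :
  phi (lieb (y k) (ad_word y a (z i))) = phi (ad_word y (incr_nth a k) (z i)).
Proof.
rewrite phi_hom.2 !val_z word_eval_incr liebZr (ut3_YZ (val_y_deg1 k) (phi_z i)).
by rewrite scalerA mulrC.
Qed.

Lemma val_y_w k b j :
  phi (lieb (y k) (ad_word y b (w j))) = phi (ad_word y (incr_nth b k) (w j)).
Proof.
rewrite phi_hom.2 !val_w word_eval_incr liebZr (ut3_YW (val_y_deg1 k) (phi_w j)).
by rewrite scalerA mulrC.
Qed.

Lemma val_y_yy k a i j : phi (lieb (y k) (ad_word y a (lieb (y i) (y j)))) =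
  phi (ad_word y (incr_nth a k) (lieb (y i) (y j))).
Proof.
rewrite phi_hom.2 !val_yy word_eval_incr liebZr.
rewrite (ut3_YE (val_y_deg1 k) (ut3_YY_e13 (val_y_deg1 i) (val_y_deg1 j))).
by rewrite scalerA mulrC.
Qed.

Lemma val_y_zw k a i b j :
  phi (lieb (y k) (lieb (ad_word y a (z i)) (ad_word y b (w j)))) =
  phi (lieb (ad_word y (incr_nth a k) (z i)) (ad_word y b (w j)) +
       lieb (ad_word y a (z i)) (ad_word y (incr_nth b k) (w j))).
Proof.
rewrite lieb_leibniz !(linear_mapD phi_hom.1) phi_hom.2 val_y_z -phi_hom.2.
by rewrite [phi (lieb _ (lieb _ _))]phi_hom.2 val_y_w -phi_hom.2.
Qed.

Lemma val_z_z k a i : phi (lieb (z k) (ad_word y a (z i))) = 0.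
Proof.
by rewrite phi_hom.2 val_z liebZr (ut3_ZZ (phi_z k) (phi_z i)) scaler0.
Qed.

Lemma val_w_w k b j : phi (lieb (w k) (ad_word y b (w j))) = 0.
Proof.
by rewrite phi_hom.2 val_w liebZr (ut3_WW (phi_w k) (phi_w j)) scaler0.
Qed.

Lemma val_z_zw k a i b j :
  phi (lieb (z k) (lieb (ad_word y a (z i)) (ad_word y b (w j)))) = 0.
Proof.
rewrite phi_hom.2 val_zw liebZr.
by rewrite (ut3_ZE (phi_z k) (ut3_ZW_e13 (phi_z i) (phi_w j))) scaler0.
Qed.

Lemma val_w_zw k a i b j :
  phi (lieb (w k) (lieb (ad_word y a (z i)) (ad_word y b (w j)))) = 0.
Proof.
rewrite phi_hom.2 val_zw liebZr.
by rewrite (ut3_WE (phi_w k) (ut3_ZW_e13 (phi_z i) (phi_w j))) scaler0.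
Qed.

Lemma val_z_yy k a i j : phi (lieb (z k) (ad_word y a (lieb (y i) (y j)))) = 0.
Proof.
rewrite phi_hom.2 val_yy liebZr.
by rewrite (ut3_ZE (phi_z k) (ut3_YY_e13 (val_y_deg1 i) (val_y_deg1 j))) scaler0.
Qed.

Lemma val_w_yy k a i j : phi (lieb (w k) (ad_word y a (lieb (y i) (y j)))) = 0.
Proof.
rewrite phi_hom.2 val_yy liebZr.
by rewrite (ut3_WE (phi_w k) (ut3_YY_e13 (val_y_deg1 i) (val_y_deg1 j))) scaler0.
Qed.

Lemma val_other i d : d <> 1%g -> d <> g -> d <> (g^-1)%g ->
  phi (free_gen K (i, d)) = 0.
Proof.
move=> d1 dg dgV; apply: (Gamma_other d1 dg dgV).
by apply: phig.2; exact: grading_gen.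
Qed.

End Values.

Let Id0 x : (forall phi : L -> UT3 K, graded_hom grading Gam phi -> phi x = 0) ->
  Id x.
Proof. by []. Qed.

Inductive normal_form : L -> Prop :=
| normal_form_y i : normal_form (y i)
| normal_form_z a i : normal_form (ad_word y a (z i))
| normal_form_w b j : normal_form (ad_word y b (w j))
| normal_form_zw a i b j :
    normal_form (lieb (ad_word y a (z i)) (ad_word y b (w j)))
| normal_form_yy a i j : normal_form (ad_word y a (lieb (y i) (y j))).

(** By [free_ad_ind] it suffices to bracket a generator with a normal form. Modulo [Id] the result
    is zero, a normal form up to sign, or a sum of two, as its values in UT3 show. *)
Lemma span_normal_form x : span (Id `|` normal_form) x.
Proof.
pose V := span (Id `|` normal_form); rewrite -/(V x).
have Vsub : submod_closed (mem V) by exact: span_submod.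
have IdV u : Id u -> V u by move=> Iu; apply: subset_span; left.
have nfV u : normal_form u -> V u by move=> nu; apply: subset_span; right.
have Vcong u v : Id (u - v) -> V v -> V u by move=> /IdV; exact: submod_cong.
move: x; apply: free_ad_ind => // [[i d]|[k d] x].
  have [->|d1] := pselect (d = 1%g); first exact: (nfV _ (normal_form_y i)).
  have [->|dg] := pselect (d = g); first exact: (nfV _ (normal_form_z [::] i)).
  have [->|dgV] := pselect (d = (g^-1)%g).
    exact: (nfV _ (normal_form_w [::] i)).
  by apply: IdV; apply: Id0 => phi phig; exact: val_other.
have [->|d1] := pselect (d = 1%g).
  apply: (span_image (lieb_linearr (y k))) => // {}x [Ix|nx].
    by apply: IdV; exact: Idad.
  case: x / nx => [i|a i|b j|a i b j|a i j].
  - exact: (nfV _ (normal_form_yy [::] k i)).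
  - apply: Vcong (nfV _ (normal_form_z (incr_nth a k) i)).
    by apply: graded_identitiesP => phi phig; exact: val_y_z.
  - apply: Vcong (nfV _ (normal_form_w (incr_nth b k) j)).
    by apply: graded_identitiesP => phi phig; exact: val_y_w.
  - apply: Vcong (submodD Vsub (nfV _ (normal_form_zw (incr_nth a k) i b j))
                               (nfV _ (normal_form_zw a i (incr_nth b k) j))).
    by apply: graded_identitiesP => phi phig; exact: val_y_zw.
  - apply: Vcong (nfV _ (normal_form_yy (incr_nth a k) i j)).
    by apply: graded_identitiesP => phi phig; exact: val_y_yy.
have [->|dg] := pselect (d = g).
  apply: (span_image (lieb_linearr (z k))) => // {}x [Ix|nx].
    by apply: IdV; exact: Idad.
  case: x / nx => [i|a i|b j|a i b j|a i j].
  - rewrite liebC; apply: (submodN Vsub).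
    apply: Vcong (nfV _ (normal_form_z (incr_nth [::] i) k)).
    by apply: graded_identitiesP => phi phig; exact: (val_y_z phig i [::]).
  - by apply: IdV; apply: Id0 => phi phig; exact: val_z_z.
  - exact: (nfV _ (normal_form_zw [::] k b j)).
  - by apply: IdV; apply: Id0 => phi phig; exact: val_z_zw.
  - by apply: IdV; apply: Id0 => phi phig; exact: val_z_yy.
have [->|dgV] := pselect (d = (g^-1)%g).
  apply: (span_image (lieb_linearr (w k))) => // {}x [Ix|nx].
    by apply: IdV; exact: Idad.
  case: x / nx => [i|a i|b j|a i b j|a i j].
  - rewrite liebC; apply: (submodN Vsub).
    apply: Vcong (nfV _ (normal_form_w (incr_nth [::] i) k)).
    by apply: graded_identitiesP => phi phig; exact: (val_y_w phig i [::]).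
  - rewrite liebC; apply: (submodN Vsub).
    exact: (nfV _ (normal_form_zw a i [::] k)).
  - by apply: IdV; apply: Id0 => phi phig; exact: val_w_w.
  - by apply: IdV; apply: Id0 => phi phig; exact: val_w_zw.
  - by apply: IdV; apply: Id0 => phi phig; exact: val_w_yy.
move=> _; apply: IdV; apply: Id0 => phi phig.
by rewrite phig.1.2 (val_other phig k d1 dg dgV) lieb0l.
Qed.

Section Substitution.
Variables Y Z W : nat -> L.

Definition subst : L -> L := free_lift (fun v : nat * G =>
  if v.2 == 1%g then Y v.1 else if v.2 == g then Z v.1 else
  if v.2 == (g^-1)%g then W v.1 else 0).

Lemma subst_hom : lie_hom subst. Proof. exact: free_lift_hom. Qed.

Lemma subst_y i : subst (y i) = Y i.
Proof. by rewrite /subst free_lift_gen /= eqxx. Qed.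

Lemma subst_z i : subst (z i) = Z i.
Proof.
rewrite /subst free_lift_gen /= eqxx; case: eqP => // g1.
by case: g2; rewrite g1 expg1n.
Qed.

Lemma subst_w i : subst (w i) = W i.
Proof.
rewrite /subst free_lift_gen /= eqxx; case: eqP => [gV1|_].
  by case: g2; rewrite -[g]invgK gV1 invg1 expg1n.
by case: eqP => // gVg; case: g2; rewrite expgS expg1 -{2}gVg mulgV.
Qed.

Lemma subst_graded :
  (forall i, grading 1%g (Y i)) -> (forall i, grading g (Z i)) ->
  (forall i, grading (g^-1)%g (W i)) -> graded_hom grading grading subst.
Proof.
move=> Yg Zg Wg; apply: graded_free_lift => -[i d] /=.
case: eqP => [->//|_]; case: eqP => [->//|_]; case: eqP => [->//|_].
exact: (submod0 (span_submod _)).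
Qed.

End Substitution.

(** All four families are indexed by [mon], so that one reduction serves them; each ignores the
    positions and exponents that it lacks. *)
Let Ez (m : mon) : L := ad_word y (unzip1 m.2) (z m.1.1).
Let Ew (m : mon) : L := ad_word y (unzip2 m.2) (w m.1.2).
Let Ezw (m : mon) : L := lieb (Ez m) (Ew m).
Let Eyy (m : mon) : L := ad_word y (unzip1 m.2) (lieb (y m.1.1) (y m.1.2)).

Let closed (T : set L) : Prop := T_ideal T /\ Id `<=` T.

Let closed_submod T : closed T -> submod_closed (mem T).
Proof. by case=> -[[]]. Qed.

Let closed_Id : closed Id. Proof. by []. Qed.

Let Id_closed T : closed T -> Id `<=` T. Proof. by case. Qed.

Let closed_ad T x u : closed T -> T u -> T (lieb x u).
Proof. by case=> -[[_ Tad] _] _; exact: Tad. Qed.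

Let closed_hom T phi x :
  closed T -> graded_hom grading grading phi -> T x -> T (phi x).
Proof. by case=> -[_ Tend] _ phig; exact: Tend. Qed.

Let grading_word a d x : grading d x -> grading d (ad_word y a x).
Proof.
move=> dx; apply: (@ad_word_ind _ _ (grading d)) => // k u du.
by rewrite -[d]mul1g; apply: grading_lieb => //; exact: grading_gen.
Qed.

Let yg i : grading 1%g (y i). Proof. exact: grading_gen. Qed.
Let zg i : grading g (z i). Proof. exact: grading_gen. Qed.
Let wg i : grading (g^-1)%g (w i). Proof. exact: grading_gen. Qed.
Let grading0 d : grading d 0.
Proof. exact: (submod0 (span_submod _)). Qed.

(** * Scripts realised on the free algebra *)

Section Script.
Variable s : script.
Let pos := script_pos s.
Let letters := unzip2 s.
Let szE m : valid (script_size s) m -> size m.2 = script_size s.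
Proof. by case. Qed.

(** Renames the variables y along the script and multiplies z and w by the monomials of its first
    and second exponents. *)
Let Phi := subst (y \o pos) (fun k => ad_word y (unzip1 letters) (z (pos k)))
  (fun k => ad_word y (unzip2 letters) (w (pos k))).

Let Phi_graded : graded_hom grading grading Phi.
Proof. by apply: subst_graded => i; rewrite //=; apply: grading_word. Qed.

Section Values.
Variable phi : L -> UT3 K.
Hypothesis phig : graded_hom grading Gam phi.
Let psig := graded_hom_comp phig Phi_graded.

Let entryE i : (phi \o Phi) (y i) = phi (y (pos i)).
Proof. by rewrite /= /Phi subst_y. Qed.

Lemma val_script_z m : valid (script_size s) m ->
  phi (Phi (Ez m)) = phi (Ez (act s m)).
Proof.
move=> vm; rewrite -[phi (Phi _)]/((phi \o Phi) _) val_z //= /Phi subst_z !val_z //.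
rewrite scalerA -(word_eval_script (p := fst) _ _ (szE vm)) //; congr (_ * _ *: _).
by congr word_eval; apply/funext => k; rewrite /alpha !entryE.
Qed.

Lemma val_script_w m : valid (script_size s) m ->
  phi (Phi (Ew m)) = phi (Ew (act s m)).
Proof.
move=> vm; rewrite -[phi (Phi _)]/((phi \o Phi) _) val_w //= /Phi subst_w !val_w //.
rewrite scalerA -(word_eval_script (p := snd) _ _ (szE vm)) //; congr (_ * _ *: _).
by congr word_eval; apply/funext => k; rewrite /beta !entryE.
Qed.

Lemma val_script_zw m : valid (script_size s) m ->
  phi (Phi (Ezw m)) = phi (Ezw (act s m)).
Proof.
have [[_ PhiB] _] := Phi_graded; have [[_ phiB] _] := phig.
by move=> vm; rewrite PhiB !phiB val_script_z // val_script_w.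
Qed.

(** Brackets of the y contain no z or w to absorb the monomial, so it is applied after the renaming;
    the values of these brackets are common eigenvectors with eigenvalues [gamma]. *)
Lemma val_script_yy m : valid (script_size s) m ->
  phi (ad_word y (unzip1 letters) (Phi (Eyy m))) = phi (Eyy (act s m)).
Proof.
move=> vm; rewrite lie_hom_ad_word; last exact: phig.1.
rewrite (@ad_word_eigen _ _ _ (gamma phi)) => [|k]; last first.
  rewrite -[phi (Phi _)]/((phi \o Phi) _) val_yy // !entryE liebZr.
  rewrite (ut3_YE (val_y_deg1 phig k) (ut3_YY_e13 _ _)); [|exact: val_y_deg1..].
  by rewrite !scalerA mulrC.
rewrite -[phi (Phi _)]/((phi \o Phi) _) val_yy // !entryE val_yy // scalerA mulrC.
rewrite -(word_eval_script (p := fst) _ _ (szE vm)) //; congr (_ * _ *: _).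
by congr word_eval; apply/funext => k; rewrite /gamma !entryE.
Qed.

End Values.
Let Phi_closed T : closed T -> forall x, T x -> T (Phi x).
Proof. by move=> cT x; exact: closed_hom. Qed.

Let scripted (E : mon -> L) := exists Psi : L -> L,
  [/\ linear Psi, forall T, closed T -> forall x, T x -> T (Psi x) &
      forall m, valid (script_size s) m -> Id (Psi (E m) - E (act s m))].

Lemma scripted_z : scripted Ez.
Proof.
exists Phi; split=> [||m vm]; [exact: Phi_graded.1.1|exact: Phi_closed|].
by apply: graded_identitiesP => phi phig; exact: val_script_z.
Qed.

Lemma scripted_w : scripted Ew.
Proof.
exists Phi; split=> [||m vm]; [exact: Phi_graded.1.1|exact: Phi_closed|].
by apply: graded_identitiesP => phi phig; exact: val_script_w.
Qed.

Lemma scripted_zw : scripted Ezw.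
Proof.
exists Phi; split=> [||m vm]; [exact: Phi_graded.1.1|exact: Phi_closed|].
by apply: graded_identitiesP => phi phig; exact: val_script_zw.
Qed.

Lemma scripted_yy : scripted Eyy.
Proof.
exists (ad_word y (unzip1 letters) \o Phi); split=> [a u v|T cT x Tx|m vm] /=.
- by rewrite Phi_graded.1.1 ad_word_linear.
- by apply: (@ad_word_ind _ _ T) => [k u|]; [exact: closed_ad|exact: Phi_closed].
- by apply: graded_identitiesP => phi phig; exact: val_script_yy.
Qed.

End Script.

Let unzip1_pad (m : seq letter) k :
  unzip1 (m ++ nseq k (0, 0)%N) = unzip1 m ++ nseq k 0%N.
Proof. by rewrite /unzip1 map_cat map_nseq. Qed.

Let unzip2_pad (m : seq letter) k :
  unzip2 (m ++ nseq k (0, 0)%N) = unzip2 m ++ nseq k 0%N.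
Proof. by rewrite /unzip2 map_cat map_nseq. Qed.

Let family_basis (E : mon -> L) J := exists S : seq L, (forall x, x \in S -> J x) /\
    forall T, closed T -> (forall x, x \in S -> T x) ->
    forall x, J x -> span (Id `|` range E) x -> T x.

Let basis_z J : closed J -> family_basis Ez J.
Proof.
apply: leading_term_basis => //; last exact: scripted_z.
by move=> i j u k; rewrite /Ez /= unzip1_pad ad_word_pad.
Qed.

Let basis_w J : closed J -> family_basis Ew J.
Proof.
apply: leading_term_basis => //; last exact: scripted_w.
by move=> i j u k; rewrite /Ew /= unzip2_pad ad_word_pad.
Qed.

Let basis_zw J : closed J -> family_basis Ezw J.
Proof.
apply: leading_term_basis => //; last exact: scripted_zw.
by move=> i j u k; rewrite /Ezw /Ez /Ew /= unzip1_pad unzip2_pad !ad_word_pad.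
Qed.

Let basis_yy J : closed J -> family_basis Eyy J.
Proof.
apply: leading_term_basis => //; last exact: scripted_yy.
by move=> i j u k; rewrite /Eyy /= unzip1_pad ad_word_pad.
Qed.

(* These keep only the variables y and z, y and w, y, and y_i respectively. *)
Let pz := subst y z (fun=> 0).
Let pw := subst y (fun=> 0) w.
Let py := subst y (fun=> 0) (fun=> 0).
Let pv i := subst (fun k => if k == i then y i else 0) (fun=> 0) (fun=> 0).

Let pz_graded : graded_hom grading grading pz.
Proof. by apply: subst_graded => // i; exact: grading0. Qed.
Let pw_graded : graded_hom grading grading pw.
Proof. by apply: subst_graded => // i; exact: grading0. Qed.
Let py_graded : graded_hom grading grading py.
Proof. by apply: subst_graded => // i; exact: grading0. Qed.
Let pv_graded i : graded_hom grading grading (pv i).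
Proof.
by apply: subst_graded => k; try case: eqP => // _; exact: grading0.
Qed.

Let substE Y Z W :
  (forall i, subst Y Z W (y i) = Y i) *
  (forall a i, subst Y Z W (ad_word y a (z i)) = ad_word Y a (Z i)) *
  (forall b j, subst Y Z W (ad_word y b (w j)) = ad_word Y b (W j)) *
  (forall a i b j, subst Y Z W (lieb (ad_word y a (z i)) (ad_word y b (w j))) =
    lieb (ad_word Y a (Z i)) (ad_word Y b (W j))) *
  (forall a i j, subst Y Z W (ad_word y a (lieb (y i) (y j))) =
    ad_word Y a (lieb (Y i) (Y j))).
Proof.
have substH := subst_hom Y Z W; have substB := substH.2.
have Yy : subst Y Z W \o y = Y by apply/funext => k; exact: subst_y.
by split; [split; [split; [split|]|]|] => *;
  rewrite ?substB ?(lie_hom_ad_word _ _ _ substH) ?Yy ?substB ?subst_y ?subst_z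
    ?subst_w.
Qed.

Let span_family (E : mon -> L) (f : L -> L) :
  linear f -> (forall x, Id x -> Id (f x)) ->
  (forall x, normal_form x -> f x = 0 \/ exists m, f x = E m) ->
  forall x, span (Id `|` range E) (f x).
Proof.
move=> fL fId fnf x; apply: (span_image fL) (span_normal_form x).
  exact: span_submod.
move=> u [Iu|/fnf[->|[m ->]]].
- by apply: subset_span; left; exact: fId.
- exact: (submod0 (span_submod _)).
- by apply: subset_span; right; exists m.
Qed.

Let zip0 (a : seq nat) := zip a (nseq (size a) 0%N).

Let unzip_zip0 a : unzip1 (zip0 a) = a.
Proof. by rewrite unzip1_zip // size_nseq. Qed.

Let hom_Id phi x : graded_hom grading grading phi -> Id x -> Id (phi x).
Proof. exact: closed_hom. Qed.

(** [pz] keeps the forms in y and z, and subtracting [py] removes those in y alone, leaving the y^a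
    z_i. *)
Let span_z x : span (Id `|` range Ez) (pz x - py x).
Proof.
apply: (span_family (f := fun x => pz x - py x)) => [|u Iu|u].
- by apply: linear_sub; exact: (subst_hom _ _ _).1.
- by apply: (submodB Idsub); apply: hom_Id.
case=> [i|a i|b j|a i b j|a i j]; rewrite /pz /py !substE.
- by left; rewrite subrr.
- by right; exists (i, 0%N, zip0 a); rewrite ad_word0 subr0 /Ez /= unzip_zip0.
- by left; rewrite subrr.
- by left; rewrite !ad_word0 !lieb0r subrr.
- by left; rewrite subrr.
Qed.

Let span_w x : span (Id `|` range Ew) (pw x - py x).
Proof.
apply: (span_family (f := fun x => pw x - py x)) => [|u Iu|u].
- by apply: linear_sub; exact: (subst_hom _ _ _).1.
- by apply: (submodB Idsub); apply: hom_Id.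
case=> [i|a i|b j|a i b j|a i j]; rewrite /pw /py !substE.
- by left; rewrite subrr.
- by left; rewrite subrr.
- right; exists (0%N, j, zip (nseq (size b) 0%N) b).
  by rewrite ad_word0 subr0 /Ew /= unzip2_zip // size_nseq.
- by left; rewrite !ad_word0 !lieb0l subrr.
- by left; rewrite subrr.
Qed.

(** Inclusion-exclusion: only the forms that contain both z and w survive. *)
Let span_zw x : span (Id `|` range Ezw) ((x - pz x) - (pw x - py x)).
Proof.
apply: (span_family (f := fun x => (x - pz x) - (pw x - py x))) => [|u Iu|u].
- do 2?[apply: linear_sub]; rewrite //; exact: (subst_hom _ _ _).1.
- by do 2?[apply: (submodB Idsub)] => //; apply: hom_Id.
case=> [i|a i|b j|a i b j|a i j]; rewrite /pz /pw /py !substE.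
- by left; rewrite !subrr.
- by left; rewrite !subrr.
- by left; rewrite !ad_word0 !subr0 subrr.
(* The two exponent words are padded with zeros to a common length before pairing. *)
- right; exists (i, j, zip (a ++ nseq (size b) 0%N) (b ++ nseq (size a) 0%N)).
  rewrite !ad_word0 !lieb0l !lieb0r !subr0 /Ezw /Ez /Ew /=.
  by rewrite unzip1_zip ?unzip2_zip ?size_cat ?size_nseq 1?addnC // !ad_word_pad.
- by left; rewrite !subrr.
Qed.

(** With a single variable left every bracket vanishes, and only the linear term in y_i remains. *)
Let pv_y i x : exists c, Id (pv i x - c *: y i).
Proof.
pose W := [set x | exists c, Id (pv i x - c *: y i)]; rewrite -/(W x).
have pvL : linear (pv i) := (subst_hom _ _ _).1.
move: x (span_normal_form x); apply: span_min.
  apply: (submodP _).2; split=> [|k u v [c uc] [d vd]].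
    by exists 0; rewrite (linear_map0 pvL) scale0r subr0; exact: (submod0 Idsub).
  exists (k * c + d); rewrite pvL scalerDl -scalerA opprD addrACA -scalerBr.
  exact: (submodZD Idsub).
have Wnf u c : pv i u = c *: y i -> W u.
  by move=> uc; exists c; rewrite uc subrr; exact: (submod0 Idsub).
move=> u [Iu|].
  by exists 0; rewrite scale0r subr0; apply: hom_Id => //; exact: pv_graded.
case=> [k|a k|b j|a k b j|a k j].
- apply: (Wnf _ (k == i)%:R); rewrite /pv substE.
  by case: eqP; rewrite ?scale1r ?scale0r.
- by apply: (Wnf _ 0); rewrite /pv substE ad_word0 scale0r.
- by apply: (Wnf _ 0); rewrite /pv substE ad_word0 scale0r.
- by apply: (Wnf _ 0); rewrite /pv substE ad_word0 lieb0l scale0r.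
- apply: (Wnf _ 0); rewrite /pv substE scale0r.
  by case: eqP => _; case: eqP => _; rewrite ?liebxx ?lieb0l ?lieb0r ad_word0.
Qed.

Let span_yy x : exists n, span (Id `|` range Eyy) (py x - \sum_(i < n) pv i x).
Proof.
pose rest n x := py x - \sum_(i < n) pv i x.
pose V := span (Id `|` range Eyy).
(* Only finitely many linear terms occur, so every large enough [n] removes them all; quantifying
   over all of these makes [W] a subspace. *)
pose W := [set x | exists n0, forall n, (n0 <= n)%N -> V (rest n x)].
suff [n0 xn0] : W x by exists n0; exact: xn0.
have Vsub : submod_closed (mem V) by exact: span_submod.
have pvL i : linear (pv i) := (subst_hom _ _ _).1.
have pyL : linear py := (subst_hom _ _ _).1.
move: x (span_normal_form x); apply: span_min.
  apply: (submodP _).2; split=> [|k u v [n un] [n' vn']].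
    exists 0%N => n _; rewrite /rest (linear_map0 pyL) big1 ?subr0; last first.
      by move=> i _; rewrite (linear_map0 (pvL _)).
    exact: (submod0 Vsub).
  exists (maxn n n') => m; rewrite geq_max => /andP[/un um /vn' vm].
  rewrite /rest pyL (eq_bigr (fun i : 'I_m => k *: pv i u + pv i v)); last first.
    by move=> i _; rewrite pvL.
  rewrite big_split -scaler_sumr opprD addrACA -scalerBr.
  exact: (submodZD Vsub).
have Wpv u : py u = 0 -> (forall i, pv i u = 0) -> W u.
  move=> pu pvu; exists 0%N => n _; rewrite /rest pu big1 ?subr0 //.
  exact: (submod0 Vsub).
move=> u [Iu|].
  exists 0%N => n _; apply: subset_span; left; apply: (submodB Idsub).
    exact: hom_Id.
  by apply: (submod_sum Idsub) => i; exact: hom_Id.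
case=> [k|a k|b j|a k b j|a k j].
- exists k.+1 => n kn; rewrite /rest /py substE (bigD1 (Ordinal kn)) //=.
  rewrite big1 => [|i /eqP ik]; rewrite /pv substE ?eqxx ?addr0 ?subrr.
    exact: (submod0 Vsub).
  by case: eqP => // ki; case: ik; exact: val_inj.
- by apply: Wpv => [|i]; rewrite /py /pv substE ad_word0.
- by apply: Wpv => [|i]; rewrite /py /pv substE ad_word0.
- by apply: Wpv => [|i]; rewrite /py /pv substE ad_word0 lieb0l.
exists 0%N => n _; rewrite /rest /py substE big1 ?subr0 => [|i _]; last first.
  rewrite /pv substE.
  by case: eqP => _; case: eqP => _; rewrite ?liebxx ?lieb0l ?lieb0r ad_word0.
by apply: subset_span; right; exists (k, j, zip0 a); rewrite /Eyy /= ?unzip_zip0.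
Qed.

(** The four families give four finite sets. The linear terms need at most one more element: if some
    y_i lies in [J], so does y_0, and y_0 yields every y_i. *)
Lemma finite_basis (J : set L) : T_ideal J -> Id `<=` J ->
  exists S : seq L, (forall x, x \in S -> J x) /\
    forall T, T_ideal T -> Id `<=` T -> (forall x, x \in S -> T x) -> J `<=` T.
Proof.
move=> JT IdJ; have cJ : closed J by [].
have [Sz [SzJ basis_Sz]] := basis_z cJ; have [Sw [SwJ basis_Sw]] := basis_w cJ.
have [Szw [SzwJ basis_Szw]] := basis_zw cJ.
have [Syy [SyyJ basis_Syy]] := basis_yy cJ.
have [Sy [SyJ Sy0]] : exists Sy : seq L, (forall x, x \in Sy -> J x) /\
    (J (y 0%N) -> y 0%N \in Sy).
  have [Jy|nJy] := pselect (J (y 0%N)); last by exists [::].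
  by exists [:: y 0%N]; split=> [x|_]; rewrite inE // => /eqP->.
exists (Sz ++ Sw ++ Szw ++ Syy ++ Sy); split=> [x|T TT subT ST x Jx].
  rewrite !mem_cat => /orP[/SzJ//|/orP[/SwJ//|/orP[/SzwJ//|/orP[/SyyJ//|/SyJ//]]]].
have cT : closed T by [].
have Jsub := closed_submod cJ; have Tsub := closed_submod cT.
have SzT u : u \in Sz -> T u by move=> uS; apply: ST; rewrite mem_cat uS.
have SwT u : u \in Sw -> T u by move=> uS; apply: ST; rewrite !mem_cat uS !orbT.
have SzwT u : u \in Szw -> T u by move=> uS; apply: ST; rewrite !mem_cat uS !orbT.
have SyyT u : u \in Syy -> T u by move=> uS; apply: ST; rewrite !mem_cat uS !orbT.
have Jpz : J (pz x) by exact: closed_hom.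
have Jpw : J (pw x) by exact: closed_hom.
have Jpy : J (py x) by exact: closed_hom.
have Tz : T (pz x - py x).
  exact: (basis_Sz T cT SzT _ (submodB Jsub Jpz Jpy) (span_z x)).
have Tw : T (pw x - py x).
  exact: (basis_Sw T cT SwT _ (submodB Jsub Jpw Jpy) (span_w x)).
have Tzw : T ((x - pz x) - (pw x - py x)).
  apply: (basis_Szw T cT SzwT _ _ (span_zw x)).
  by do 2?[apply: (submodB Jsub)].
have Tpv i : T (pv i x).
  have [c xc] := pv_y i x.
  (* The substitution that sends all variables of degree 1 to y_k. *)
  have shift k T' : closed T' -> forall j, T' (y j) -> T' (y k).
    move=> cT' j T'y; rewrite -(subst_y (fun=> y k) z w j).
    by apply: closed_hom => //; exact: subst_graded.
  have [c0|c_neq0] := eqVneq c 0.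
    by apply: subT; rewrite -[pv i x]subr0 -(scale0r (y i)) -c0.
  have Jpv : J (pv i x) by apply: closed_hom => //; exact: pv_graded.
  have Jyi : J (y i).
    rewrite -[y i](scalerK c_neq0); apply: (submodZ Jsub).
    by rewrite -[_ *: _](subKr (pv i x)); apply: (submodB Jsub) => //; exact: IdJ.
  have Ty0 : T (y 0%N).
    by apply: ST; rewrite !mem_cat Sy0 ?orbT //; exact: shift Jyi.
  by apply: (submod_cong Tsub (subT _ xc)); apply: (submodZ Tsub); exact: shift Ty0.
have Tpy : T (py x).
  have [n xn] := span_yy x; apply: (submod_cong Tsub (y := \sum_(i < n) pv i x)).
    apply: (basis_Syy T cT SyyT _ _ xn); apply: (submodB Jsub) => //.
    by apply: (submod_sum Jsub) => i; apply: closed_hom => //; exact: pv_graded.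
  exact: (submod_sum Tsub).
have Tpz : T (pz x) by exact: (submod_cong Tsub Tz).
(* The parts are reassembled: x is the sum of [pz x], [pw x - py x] and the mixed part. *)
apply: (submod_cong Tsub (y := pz x)) => //.
exact: (submod_cong Tsub Tzw).
Qed.

End NormalForms.

Theorem theorem3p21 (G : groupType)
    (mulGC : forall x y : G, (x * y)%g = (y * x)%g)
    (g : G) (hg : (g ^+ 2)%g <> 1%g)
    (K : fieldType) (Kinf : infinite_set [set: K])
    (J : set (freeGLie K G)) (JT : T_ideal J)
    (IdJ : graded_identities (Gamma K g (g^-1)%g) `<=` J) :
  exists S : set (freeGLie K G),
    finite_set S /\
    J = [set x + y | x in T_ideal_gen S
                   & y in graded_identities (Gamma K g (g^-1)%g)].
Proof.
have [S [SJ S_basis]] := finite_basis hg JT IdJ.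
have IdT := @graded_identities_T_ideal K G _ (Gamma K g (g^-1)%g).
have genT := @T_ideal_gen_T_ideal K G [set` S].
exists [set` S]; split; first exact: finite_seq.
apply/seteqP; split; last first.
  move=> _ [x Sx [y Iy <-]]; apply: (submodD JT.1.1); last exact: IdJ.
  by apply: Sx; split.
(* The sum of the T-ideal generated by [S] and the identities is itself a T-ideal containing both,
   so it contains [J]. *)
apply: S_basis; first exact: T_ideal_add.
  move=> y Iy; exists 0; first exact: (submod0 genT.1.1).
  by exists y; rewrite ?add0r.
move=> x Sx; exists x; first exact: sub_gen_smallest.
by exists 0; [exact: (submod0 IdT.1.1)|rewrite addr0].
Qed.
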